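(* For every real $\varepsilon$ with $0<\varepsilon<1/6$ and every positive integer $k$ there are $n_0\in\mathbb{N}$, a constant $c>0$ and a function $\delta:\mathbb{N}\to\mathbb{R}$ with $\delta(n)\to0$ as $n\to\infty$ (all depending only on $\varepsilon$ and $k$) such that for every finite set $A\subset\mathbb{Z}$ with $|A|\ge n_0$, with $\omega(a)\le k$ for each $a\in A$, and with $(\log|A|)^{1-6\varepsilon}\ge k$, one has \[\max\{|A+A|,|A\cdot A|\}\ \ge\ c\,|A|^{\frac53-\delta(|A|)}.\]
   Context: For an integer $a$, $\omega(a)$ is the number of distinct primes dividing $a$ (every prime divides $0$, so $\omega(0)=\infty$ and the condition $\omega(a)\le k$ forces $a\ne 0$). $A+A=\{a+b:a,b\in A\}$ and $A\cdot A=\{ab:a,b\in A\}$. *)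

(* Defs.v *)
From HB Require Import structures.
From mathcomp Require Import all_boot all_order all_algebra.
From mathcomp Require Import finmap.
From mathcomp Require Import all_classical all_reals all_analysis.

Set Implicit Arguments.
Unset Strict Implicit.
Unset Printing Implicit Defensive.

Import Order.TTheory GRing.Theory Num.Theory.
Import numFieldNormedType.Exports.

Local Open Scope classical_set_scope.
Local Open Scope ring_scope.

(* [counting] is +oo on infinite sets, so omega R 0 = +oo. *)
Definition omega (R : realType) (a : int) : \bar R :=
  counting [set p : nat | prime p /\ (p%:Z %| a)%Z].

Definition sumset (A : {fset int}) : {fset int} :=
  [fset (a + b)%R | a in A, b in A]%fset.

Definition prodset (A : {fset int}) : {fset int} :=
  [fset (a * b)%R | a in A, b in A]%fset.

(* Main.v *)
Require Import Defs.
From HB Require Import structures.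
From mathcomp Require Import all_boot all_order all_algebra.
From mathcomp Require Import finmap.
From mathcomp Require Import all_classical all_reals all_analysis.
From mathcomp Require Import ring lra zify.

(** Write N for the size of A.  Keep only the elements divisible by a prime
    which divides a non-negligible proportion of the current set, again and
    again; this stops after at most k rounds.  After one more restriction to
    a dyadic class there are a set S of at most k primes and a set B in A (or
    in -A) of N^(1-o(1)) positive integers such that every prime outside S
    divides a small proportion of the elements of B, and such that the
    elements of B have n different S-free parts (the largest factors prime to
    S), all of them taken about equally often ([heavy_primes],
    [dyadic_fibers]).

    Products: two typical elements of B have coprime S-free parts, and a
    product of two coprime numbers with few prime factors has few
    factorizations of this kind.  So |B| n <= C |B B| ([product_bound]).

    Sums: |B|^3 <= |B|^o(1) |B + B| max(n^2, |B|) ([sumset_bound]).  Either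
    |B + B| >= |B|^(2-o(1)), or both bounds together give
    |B + B| |B B|^2 >= |B|^(5-o(1)); hence the exponent 5/3
    ([sum_product_nat]).

    The bound for sums estimates the fourth moment of F(t) = sum of cos(a t)
    over a in B.  Split F into pieces F_v by the S-part v of the frequency.
    As in the theory of lacunary series, for every q there is a constant with
    E F^(2q) <= C E Q^q, where Q is the sum of the F_v^2
    ([square_function]; valuations at a prime p act as a reversed
    martingale).  It remains to see that E Q^2 is not much larger than
    Z max(1, Z), where Z = E Q and where the functions are scaled so that the
    coefficients of every F_v add up to at most 1.

    For this the square function inequality is applied to Q itself.  By the
    product-to-sum formula Q - Z is a sum of cosines of v (b - b') t and
    v (b + b') t; taking out the S-part of b - b' and of b + b' brings it
    into the shape that F had ([square_sum_next]), with a new function Q' and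
    with Z' = E Q' <= E Q^2.  Let s be the norm of Q in L^p, with p large,
    and s' that of Q' in L^(p/2).  Then s <= Z + C s'^(1/2), and E Q^2 is
    at most |B|^o(1) s max(1, Z).  The trivial bound s <= |B| holds for all
    these functions, and each application of the two inequalities improves
    s <= |B|^o(1) (max(1, Z) + |B|^x) to the same bound with x/2 in place of
    x, for an exponent p twice as large ([moment_bound]).  In the limit s <= |B|^o(1) max(1, Z), as desired. *)

Set Implicit Arguments.
Unset Strict Implicit.
Unset Printing Implicit Defensive.

Import Order.TTheory GRing.Theory Num.Theory.
Import numFieldNormedType.Exports.

Local Open Scope ring_scope.

(** * Cosines on a finite cyclic group *)

Lemma cosD2piz (R : realType) (a : R) (n : int) :
  cos (a + 2 * pi * n%:~R) = cos a.
Proof.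
have pos (b : R) (k : nat) : cos (b + 2 * pi * k%:R) = cos b.
  elim: k b => [|k IH] b; first by rewrite mulr0 addr0.
  rewrite -[k.+1%:R]natr1 mulrDr mulr1 addrA.
  by rewrite cosD mulr_natl cos2pi sin2pi mulr1 mulr0 subr0 -mulr_natl IH.
case: n => k; first exact: pos.
rewrite -[LHS](pos _ k.+1) NegzE mulrNz mulrN -pmulrn subrK //.
Qed.

Lemma cos_neq1 (R : realType) (d : nat) (x : int) : (0 < d)%N ->
  ~~ (d%:Z %| x)%Z -> cos (2 * pi * x%:~R / d%:R : R) != 1.
Proof.
move=> d0 ndx.
have dR : (0 < d%:R :> R) by rewrite ltr0n.
have dn0 : d%:R != 0 :> R by rewrite gt_eqF.
have pi0 := pi_gt0 R.
pose r := `|(x %% d%:Z)%Z|%N.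
have re : (x %% d%:Z)%Z = r%:Z by rewrite /r gez0_abs // modz_ge0 // eqz_nat -lt0n.
have rlt : (r < d)%N by rewrite -ltz_nat -re ltz_pmod.
have r0 : (0 < r)%N.
  by rewrite lt0n; apply: contra ndx => /eqP r0; apply/dvdz_mod0P; rewrite re r0.
have -> : 2 * pi * x%:~R / d%:R = 2 * pi * r%:R / d%:R + 2 * pi * (x %/ d%:Z)%Z%:~R :> R.
  rewrite {1}(divz_eq x d) re intrD intrM -!pmulrn; by field.
rewrite cosD2piz.
have key (s : nat) : (0 < s)%N -> (s * 2 <= d)%N -> cos (2 * pi * s%:R / d%:R : R) != 1.
  move=> s0 sd; apply/eqP; rewrite -[RHS](cos0 R) => /cos_inj H.
  have s0R : (0 : R) < s%:R by rewrite ltr0n.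
  have : 2 * pi * s%:R / d%:R = 0 :> R.
    apply: H; rewrite in_itv /=.
      apply/andP; split; first by rewrite divr_ge0 ?mulr_ge0 ?ler0n ?ltW.
      rewrite ler_pdivrMr // (_ : 2 * pi * s%:R = pi * (s * 2)%:R).
        by rewrite ler_pM2l // ler_nat.
      by rewrite natrM; ring.
    by rewrite lexx ltW.
  by apply/eqP; rewrite gt_eqF // divr_gt0 // !mulr_gt0.
have [le|gt] := leqP (r * 2) d; first exact: key.
have -> : 2 * pi * r%:R / d%:R = - (2 * pi * (d - r)%:R / d%:R) + 2 * pi * 1%:~R :> R.
  by rewrite natrB 1?ltnW //; field.
rewrite cosD2piz cosN; apply: key; lia.
Qed.

(** The sum S(a) is unchanged when a is increased by the common difference b,
    since this permutes the terms modulo 2 pi.  As S(a + b) + S(a - b) is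
    2 (cos b) S(a), and cos b is not 1, the sum vanishes. *)
Lemma sum_cos_ap (R : realType) (d : nat) (x : int) (a : R) : (0 < d)%N ->
  ~~ (d%:Z %| x)%Z ->
  \sum_(k < d) cos (a + 2 * pi * x%:~R / d%:R * k%:R) = 0.
Proof.
move=> d0 ndx; set b := 2 * pi * x%:~R / d%:R.
pose S (a : R) := \sum_(k < d) cos (a + b * k%:R).
have shift c : S (c + b) = S c.
  apply/eqP; rewrite -subr_eq0 /S -sumrB.
  have -> : \sum_(k < d) (cos (c + b + b * k%:R) - cos (c + b * k%:R))
            = \sum_(0 <= k < d) (cos (c + b * k.+1%:R) - cos (c + b * k%:R)).
    rewrite big_mkord; apply: eq_bigr => k _; congr (cos _ - _).
    by rewrite -[k.+1%:R]natr1; ring.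
  rewrite (telescope_sumr (fun k => cos (c + b * k%:R))) //.
  rewrite mulr0 addr0 (_ : b * d%:R = 2 * pi * x%:~R) ?cosD2piz ?subrr //.
  by rewrite /b divfK // pnatr_eq0 -lt0n.
have eqS : S (a + b) + S (a - b) = 2 * cos b * S a.
  rewrite /S -big_split /= mulr_sumr; apply: eq_bigr => k _.
  rewrite (_ : a + b + b * k%:R = (a + b * k%:R) + b); last by ring.
  rewrite (_ : a - b + b * k%:R = (a + b * k%:R) - b); last by ring.
  rewrite cosD cosB; ring.
have : 2 * (1 - cos b) * S a = 0.
  have e1 := shift a; have e2 := shift (a - b); rewrite subrK in e2.
  rewrite mulrBr mulrBl -eqS e1 -e2; ring.
move/eqP; rewrite mulf_eq0 mulf_eq0 pnatr_eq0 /= subr_eq0 eq_sym.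
by rewrite (negbTE (cos_neq1 R d0 ndx)) => /eqP.
Qed.

Section Torus.
Variables (R : realType) (N : nat).
Notation Th := 'I_N.+1.

(** The real characters of the cyclic group of order N.+1; cosines are enough
    because all functions below have even Fourier coefficients. *)
Definition chi (x : int) (t : Th) : R :=
  cos (2 * pi * x%:~R / N.+1%:R * (t : nat)%:R).

Definition mean (h : Th -> R) : R := (\sum_t h t) / N.+1%:R.

(** When d divides N.+1, these are the elements of the subgroup of order d. *)
Definition shift (d k : nat) : Th := inZp (k * (N.+1 %/ d)).

(** Translation form of: all frequencies are divisible by d.  Stated this way
    the property passes to sums, products and powers at no cost. *)
Definition invariant_by (d : nat) (h : Th -> R) :=
  forall t k, h (t + shift d k) = h t.

(** Translation form of: no frequency is divisible by d. *)
Definition null_on (d : nat) (h : Th -> R) :=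
  forall t, \sum_(k < d) h (t + shift d k) = 0.

Lemma chi_inZp x (n : nat) :
  chi x (inZp n) = cos (2 * pi * x%:~R / N.+1%:R * n%:R).
Proof.
have M0 : N.+1%:R != 0 :> R by rewrite pnatr_eq0.
rewrite /chi /= -[LHS](cosD2piz _ (x * (n %/ N.+1)%N)); congr cos.
rewrite [in RHS](divn_eq n N.+1) natrD natrM intrM -pmulrn.
by move: (N.+1%:R : R) M0 => M M0; field.
Qed.

Lemma chiD x (t : Th) (n : nat) :
  chi x (t + inZp n) = cos (2 * pi * x%:~R / N.+1%:R * t%:R
                             + 2 * pi * x%:~R / N.+1%:R * n%:R).
Proof.
rewrite -mulrDr -natrD -chi_inZp; congr chi; apply: val_inj => /=.
by rewrite modnDmr.
Qed.

Lemma chi_shift x (t : Th) d k : (d %| N.+1)%N ->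
  chi x (t + shift d k) = cos (2 * pi * x%:~R / N.+1%:R * t%:R
                             + 2 * pi * x%:~R / d%:R * k%:R).
Proof.
move=> dN; rewrite chiD; congr (cos (_ + _)).
have d0 : (0 < d)%N by apply: dvdn_gt0 dN.
have dR : d%:R != 0 :> R by rewrite pnatr_eq0 -lt0n.
have NR : N.+1%:R != 0 :> R by rewrite pnatr_eq0.
apply: (mulIf NR); rewrite natrM natf_div // .
by field; rewrite dR addrC natr1 NR.
Qed.

Lemma invariant_chi d x : (d %| N.+1)%N -> (d%:Z %| x)%Z -> invariant_by d (chi x).
Proof.
move=> dN /dvdzP [q ->] t k; rewrite chi_shift //.
rewrite -[RHS](cosD2piz _ (q * k%:Z)); congr (cos (_ + _)).
have d0 : (0 < d)%N by apply: dvdn_gt0 dN.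
by rewrite !intrM -!pmulrn; field; rewrite pnatr_eq0 -lt0n.
Qed.

Lemma null_chi d x : (d %| N.+1)%N -> ~~ (d%:Z %| x)%Z -> null_on d (chi x).
Proof.
move=> dN ndx t; have d0 : (0 < d)%N by apply: dvdn_gt0 dN.
under eq_bigr => k _ do rewrite chi_shift //.
exact: sum_cos_ap.
Qed.

Lemma mean_null d h : (0 < d)%N -> null_on d h -> mean h = 0.
Proof.
move=> d0 nh; rewrite /mean; suff -> : \sum_t h t = 0 by rewrite mul0r.
have : d%:R * \sum_t h t = 0.
  transitivity (\sum_(k < d) \sum_t h (t + shift d k)); last first.
    by rewrite exchange_big big1.
  rewrite mulr_natl -[in LHS](card_ord d) -sumr_const; apply: eq_bigr => k _.
  by rewrite [LHS](reindex_inj (addIr (shift d k))).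
by move/eqP; rewrite mulf_eq0 pnatr_eq0 -[(d == 0)%N]negbK -lt0n d0 => /eqP.
Qed.

Lemma invariant_dvd d d' h : (d %| d')%N -> (d' %| N.+1)%N ->
  invariant_by d' h -> invariant_by d h.
Proof.
move=> /dvdnP [q ->] dN H t k; rewrite -[RHS](H t (k * q)); congr (h (_ + inZp _)).
have qd0 : (0 < q * d)%N by apply: dvdn_gt0 dN.
have [d0 q0] : (0 < d)%N /\ (0 < q)%N by move: qd0; rewrite muln_gt0 => /andP[].
case/dvdnP: dN => m ->; rewrite mulnK // mulnA mulnK //.
by rewrite [(m * q)%N]mulnC mulnA.
Qed.

(** In terms of frequencies: adding a multiple of d to a number which is not a
    multiple of d does not produce a multiple of d. *)
Lemma null_mul d g h : invariant_by d g -> null_on d h -> null_on d (fun t => g t * h t).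
Proof.
move=> ig nh t; under eq_bigr => k _ do rewrite ig.
by rewrite -mulr_sumr nh mulr0.
Qed.

Lemma null_sum d (I : finType) (P : pred I) (h : I -> Th -> R) :
  (forall i, P i -> null_on d (h i)) -> null_on d (fun t => \sum_(i | P i) h i t).
Proof. by move=> H t; rewrite exchange_big big1 // => i Pi; rewrite H. Qed.

Lemma invariant_sum d (I : finType) (P : pred I) (h : I -> Th -> R) :
  (forall i, P i -> invariant_by d (h i)) ->
  invariant_by d (fun t => \sum_(i | P i) h i t).
Proof. by move=> H t k; apply: eq_bigr => i Pi; rewrite H. Qed.

Lemma chi0 t : chi 0 t = 1.
Proof. by rewrite /chi mulr0 !mul0r cos0. Qed.

Lemma chiM x y t : chi x t * chi y t = (chi (x - y) t + chi (x + y) t) / 2.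
Proof.
rewrite /chi intrB intrD.
set a := 2 * pi * x%:~R / _ * _; set b := 2 * pi * y%:~R / _ * _.
rewrite (_ : _ * (_ - _) / _ * _ = a - b); last by rewrite /a /b; ring.
rewrite (_ : _ * (_ + _) / _ * _ = a + b); last by rewrite /a /b; ring.
rewrite cosB cosD; by field.
Qed.

Lemma chi_le1 x t : `|chi x t| <= 1.
Proof. exact: cos_max. Qed.

Lemma eq_mean g h : g =1 h -> mean g = mean h.
Proof. by move=> e; rewrite /mean; congr (_ / _); apply: eq_bigr. Qed.

Lemma meanD g h : mean (fun t => g t + h t) = mean g + mean h.
Proof. by rewrite /mean big_split mulrDl. Qed.

Lemma meanZ c h : mean (fun t => c * h t) = c * mean h.
Proof. by rewrite /mean -mulr_sumr mulrA. Qed.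

Lemma mean_sum (I : Type) (r : seq I) (P : pred I) (h : I -> Th -> R) :
  mean (fun t => \sum_(i <- r | P i) h i t) = \sum_(i <- r | P i) mean (h i).
Proof. by rewrite /mean exchange_big mulr_suml. Qed.

Lemma mean_le g h : (forall t, g t <= h t) -> mean g <= mean h.
Proof.
by move=> H; rewrite /mean ler_wpM2r ?invr_ge0 ?ler0n //; apply: ler_sum.
Qed.

Lemma mean_const c : mean (fun=> c) = c.
Proof.
by rewrite /mean sumr_const card_ord -[c *+ _]mulr_natr mulfK ?pnatr_eq0.
Qed.

Lemma mean_ge0 h : (forall t, 0 <= h t) -> 0 <= mean h.
Proof. by move=> H; rewrite -(mean_const 0); apply: mean_le. Qed.

Lemma mean_chi_eq0 x : ~~ (N.+1%:Z %| x)%Z -> mean (chi x) = 0.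
Proof. by move=> nx; apply: (@mean_null N.+1) => //; apply: null_chi. Qed.

Lemma mean_chi_ge0 x : 0 <= mean (chi x).
Proof.
have [dx|/mean_chi_eq0 ->] := boolP (N.+1%:Z %| x)%Z; last exact: lexx.
apply: mean_ge0 => t.
have -> : t = 0 + shift N.+1 t.
  by rewrite add0r; apply: val_inj; rewrite /= divnn muln1 modn_small.
by rewrite invariant_chi // /chi mulr0 cos0.
Qed.

(** Since all coefficients below are nonnegative, this positivity permits to
    drop any unwanted part of a product of two cosine sums from below. *)
Lemma mean_chi2_ge0 x y : 0 <= mean (fun t => chi x t * chi y t).
Proof.
under eq_mean => t do rewrite chiM mulrC.
by rewrite meanZ meanD mulr_ge0 ?invr_ge0 ?ler0n // addr_ge0 // mean_chi_ge0.
Qed.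

End Torus.

(** * Elementary inequalities for powers *)

Section Pointwise.
Variable R : realType.
Implicit Types a b c x y S L : R.

(** With a = |x|^2, c = |y|^2 and b the inner product of x and y, this expands
    a power of |x + y|^2 to second order in x.  The term linear in x is kept
    exactly, because its mean is going to vanish. *)
Lemma pow_second_order (q : nat) : exists2 C : R, 0 <= C &
  forall a b c, 0 <= a -> 0 <= c -> b ^+ 2 <= a * c ->
  (a + 2 * b + c) ^+ q.+1 <= c ^+ q.+1 + 2 * q.+1%:R * b * c ^+ q + C * a * (a + c) ^+ q.
Proof.
elim: q => [|q [C C0 IH]].
  exists 1 => // a b c a0 c0 _; rewrite !expr1 expr0; lra.
exists (1 + 6 * q.+1%:R + 2 * C) => [|a b c a0 c0 bac].
  by rewrite !addr_ge0 ?mulr_ge0 ?ler0n.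
have ac0 : 0 <= a + c by apply: addr_ge0.
have b2 : (2 * b) ^+ 2 <= (a + c) ^+ 2 by have := sqr_ge0 (a - c); lra.
have b2n : `|2 * b| <= a + c by rewrite -ler_sqr ?nnegrE ?normr_ge0 // real_normK ?num_real.
have bD : 2 * b <= a + c by apply: le_trans b2n; apply: ler_norm.
have bD' : - (2 * b) <= a + c by apply: le_trans b2n; rewrite -normrN; apply: ler_norm.
set D := a + 2 * b + c.
have D0 : 0 <= D by rewrite /D; lra.
have D2 : D <= 2 * (a + c) by rewrite /D; lra.
have cq : c ^+ q <= (a + c) ^+ q by apply: lerXn2r; rewrite ?nnegrE //; lra.
have cq1 : c ^+ q.+1 <= (a + c) ^+ q.+1 by apply: lerXn2r; rewrite ?nnegrE //; lra.
have cq0 : 0 <= c ^+ q by apply: exprn_ge0.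
have acq0 : 0 <= (a + c) ^+ q by apply: exprn_ge0.
rewrite exprS.
apply: (le_trans (ler_wpM2l D0 (IH a b c a0 c0 bac))).
rewrite mulrDr [D * (_ + _)]mulrDr -addrA.
have e1 : D * c ^+ q.+1 <= c ^+ q.+2 + 2 * b * c ^+ q.+1 + a * (a + c) ^+ q.+1.
  have -> : D * c ^+ q.+1 = c ^+ q.+2 + 2 * b * c ^+ q.+1 + a * c ^+ q.+1.
    by rewrite /D !exprS; ring.
  by rewrite lerD2l ler_wpM2l.
have e2 : D * (2 * q.+1%:R * b * c ^+ q) <=
    2 * q.+1%:R * b * c ^+ q.+1 + 6 * q.+1%:R * a * (a + c) ^+ q.+1.
  have -> : D * (2 * q.+1%:R * b * c ^+ q) = 2 * q.+1%:R * b * c ^+ q.+1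
     + 2 * q.+1%:R * ((a * b + 2 * b ^+ 2) * c ^+ q).
    by rewrite /D !exprS; ring.
  rewrite lerD2l (_ : 6 * _ * a * _ = 2 * q.+1%:R * (3 * a * (a + c) ^+ q.+1)); last by ring.
  apply: ler_wpM2l; first by rewrite mulr_ge0 ?ler0n.
  apply: (@le_trans _ _ (3 * a * (a + c) * c ^+ q)).
    by apply: ler_wpM2r => //; nra.
  rewrite [(a + c) ^+ q.+1]exprS mulrA; apply: ler_wpM2l => //.
  by rewrite !mulr_ge0.
have e3 : D * (C * a * (a + c) ^+ q) <= 2 * C * a * (a + c) ^+ q.+1.
  rewrite (_ : 2 * C * a * _ = 2 * (a + c) * (C * a * (a + c) ^+ q)).
    by apply: ler_wpM2r => //; rewrite !mulr_ge0.
  by rewrite exprS; ring.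
apply: le_trans (lerD e1 (lerD e2 e3)) _.
rewrite le_eqVlt; apply/orP; left; apply/eqP.
have -> : q.+2%:R = q.+1%:R + 1 :> R by rewrite natr1.
ring.
Qed.

Lemma exprD_le (q : nat) x y : 0 <= x -> 0 <= y ->
  (x + y) ^+ q <= 2 ^+ q * (x ^+ q + y ^+ q).
Proof.
move=> x0 y0.
wlog xy : x y x0 y0 / x <= y.
  move=> H; case/orP: (le_total x y) => h; first exact: H.
  by rewrite addrC [_ ^+ _ + _]addrC; apply: H.
apply: (@le_trans _ _ ((2 * y) ^+ q)).
  by apply: lerXn2r; rewrite ?nnegrE ?addr_ge0 ?mulr_ge0 //; lra.
by rewrite exprMn ler_wpM2l ?exprn_ge0 // lerDr exprn_ge0.
Qed.

(** A convex function lies above its tangents. *)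
Lemma expr_tangent (q : nat) x y : 0 <= x -> 0 <= y ->
  x ^+ q + q%:R * x ^+ q.-1 * (y - x) <= y ^+ q.
Proof.
case: q => [|q] x0 y0; first by rewrite !mul0r addr0.
rewrite /=; elim: q => [|q IH]; first by rewrite !expr1 expr0; lra.
have xq : 0 <= x ^+ q by apply: exprn_ge0.
rewrite [y ^+ q.+2]exprS; apply: le_trans (ler_wpM2l y0 IH).
rewrite -subr_ge0.
have -> : q.+2%:R = q.+1%:R + 1 :> R by rewrite natr1.
rewrite (_ : _ - _ = q.+1%:R * x ^+ q * (y - x) ^+ 2); last by rewrite !exprS; ring.
by apply: mulr_ge0; [apply: mulr_ge0 => //; apply: ler0n | apply: sqr_ge0].
Qed.

(** Replaces Hoelder's inequality: for large L the second term can be absorbed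
    into the moment that is being estimated. *)
Lemma young_pow (q : nat) S x L : 0 <= S -> 0 <= x -> 0 < L ->
  S * x ^+ q <= L ^+ q * S ^+ q.+1 + x ^+ q.+1 / L.
Proof.
move=> S0 x0 L0; have xq : 0 <= x ^+ q by apply: exprn_ge0.
have [le|/ltW le] := leP x (L * S).
  apply: ler_wpDr; first by rewrite divr_ge0 ?exprn_ge0 // ltW.
  rewrite [S ^+ q.+1]exprS mulrCA; apply: ler_wpM2l => //.
  by rewrite -exprMn; apply: lerXn2r => //; rewrite nnegrE mulr_ge0 // ltW.
apply: ler_wpDl; first by rewrite mulr_ge0 ?exprn_ge0 // ltW.
rewrite exprS mulrAC; apply: ler_wpM2r => //.
by rewrite ler_pdivlMr // mulrC.
Qed.

Lemma sum_pow_le (I : finType) (f : I -> R) (q : nat) : (forall i, 0 <= f i) ->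
  \sum_i f i ^+ q.+1 <= (\sum_i f i) ^+ q.+1.
Proof.
move=> f0; have S0 : 0 <= \sum_i f i by apply: sumr_ge0.
rewrite [leRHS]exprS mulr_suml; apply: ler_sum => i _; rewrite exprS.
apply: ler_wpM2l => //; apply: lerXn2r; rewrite ?nnegrE //.
by rewrite (bigD1 i) //= lerDl sumr_ge0.
Qed.

Lemma cauchy_schwarz (I : finType) (f g : I -> R) :
  (\sum_i f i * g i) ^+ 2 <= (\sum_i f i ^+ 2) * (\sum_i g i ^+ 2).
Proof.
set A := \sum_i f i ^+ 2; set B := \sum_i g i ^+ 2; set X := \sum_i _.
have A0 : 0 <= A by apply: sumr_ge0 => i _; apply: sqr_ge0.
have B0 : 0 <= B by apply: sumr_ge0 => i _; apply: sqr_ge0.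
have key u v : 0 <= u ^+ 2 * A + 2 * u * v * X + v ^+ 2 * B.
  rewrite /A /X /B !mulr_sumr -!big_split /=; apply: sumr_ge0 => i _.
  by rewrite (_ : _ + _ = (u * f i + v * g i) ^+ 2) ?sqr_ge0 //; ring.
have [B00|Bn0] := eqVneq B 0; last first.
  have := key B (- X).
  rewrite (_ : _ + _ = B * (A * B - X ^+ 2)); last by ring.
  by rewrite pmulr_rge0 ?subr_ge0 // lt0r Bn0.
rewrite B00 mulr0.
have X0 : X = 0.
  rewrite /X big1 // => i _.
  suff -> : g i = 0 by rewrite mulr0.
  apply/eqP; rewrite -sqrf_eq0; apply/eqP.
  have := B00; rewrite /B (bigD1 i) //= => /eqP.
  rewrite paddr_eq0 ?sqr_ge0 ?sumr_ge0 //; last by move=> j _; apply: sqr_ge0.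
  by move=> /andP[/eqP].
by rewrite X0 expr0n.
Qed.

End Pointwise.

(** * The square function inequality *)

(** In terms of frequencies: all of them have p-adic valuation exactly w. *)
Definition pure_at (R : realType) (N p w : nat) (h : 'I_N.+1 -> R) :=
  invariant_by (p ^ w) h /\ null_on (p ^ w.+1) h.

Section OnePrime.
Variables (R : realType) (N p K : nat) (I : finType) (F : I -> 'I_K -> 'I_N.+1 -> R).
Hypothesis pK : (p ^ K %| N.+1)%N.
Hypothesis pureF : forall i (w : 'I_K), pure_at p w (F i w).

(* The frequencies of T w are those of valuation at least w, so T w is the
   conditional expectation of T 0 on the functions invariant by p ^ w. *)
Let T (w : nat) i t := \sum_(v < K | (w <= v)%N) F i v t.
Let NT (w : nat) t := \sum_i T w i t ^+ 2.
Let a (w : 'I_K) t := \sum_i F i w t ^+ 2.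

Let p_gt0 (w : nat) : (w <= K)%N -> (0 < p ^ w)%N.
Proof.
move=> wK; have : (0 < p ^ K)%N by apply: dvdn_gt0 pK.
by rewrite !expn_gt0; case: (p) => //= /eqP K0; move: wK; rewrite K0 leqn0.
Qed.

Let dvd_pw (w v : nat) : (w <= v)%N -> (p ^ w %| p ^ v)%N.
Proof. by move=> wv; rewrite dvdn_exp2l. Qed.

Let dvdN (w : nat) : (w <= K)%N -> (p ^ w %| N.+1)%N.
Proof. by move=> wK; apply: dvdn_trans pK; apply: dvd_pw. Qed.

Let invT w i : (w <= K)%N -> invariant_by (p ^ w) (T w i).
Proof.
move=> wK; apply: invariant_sum => v wv.
apply: (@invariant_dvd R N _ (p ^ v)); rewrite ?dvd_pw ?dvdN ?[(v <= K)%N]ltnW //.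
by case: (pureF i v).
Qed.

Let inva (w : 'I_K) : invariant_by (p ^ w) (a w).
Proof. by move=> t k; apply: eq_bigr => i _; rewrite (pureF i w).1. Qed.

Let invNT w : (w <= K)%N -> invariant_by (p ^ w) (NT w).
Proof. by move=> wK t k; apply: eq_bigr => i _; rewrite invT. Qed.

Let T_rec (w : 'I_K) i t : T w i t = F i w t + T w.+1 i t.
Proof.
rewrite /T (bigD1 w) ?leqnn //=; congr (_ + _); apply: eq_bigl => v.
by rewrite ltn_neqAle andbC eq_sym.
Qed.

Let NT0 w t : 0 <= NT w t.
Proof. by apply: sumr_ge0 => i _; apply: sqr_ge0. Qed.
Let a0 w t : 0 <= a w t.
Proof. by apply: sumr_ge0 => i _; apply: sqr_ge0. Qed.

Let T0_sub (w : 'I_K) i t : T 0 i t - T w i t = \sum_(v < K | (v < w)%N) F i v t.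
Proof.
apply/eqP; rewrite subr_eq addrC /T; apply/eqP.
rewrite (bigID (fun v : 'I_K => (w <= v)%N)) /=; congr (_ + _).
by apply: eq_bigl => v; rewrite ltnNge.
Qed.

(** Conditional Jensen inequality: T w is a conditional expectation of T 0 and
    the weight a w is measurable for it.  It follows from the tangent
    inequality, whose linear term has mean zero. *)
Let jensen (w : 'I_K) q :
  mean (fun t => a w t * NT w t ^+ q) <= mean (fun t => a w t * NT 0 t ^+ q).
Proof.
pose rest t := a w t * (q%:R * NT w t ^+ q.-1 * (2 * \sum_i T w i t * (T 0 i t - T w i t))).
have rest0 : mean rest = 0.
  pose g (v : 'I_K) (i : I) t := a w t * (q%:R * NT w t ^+ q.-1 * (2 * T w i t)) * F i v t.
  have -> : mean rest = \sum_(v < K | (v < w)%N) \sum_i mean (g v i).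
    under [RHS]eq_bigr => v _ do rewrite -mean_sum.
    rewrite -mean_sum; apply: eq_mean => t; rewrite /rest /g exchange_big /=.
    under [RHS]eq_bigr => i _ do rewrite -mulr_sumr -T0_sub.
    have -> : \sum_i a w t * (q%:R * NT w t ^+ q.-1 * (2 * T w i t)) * (T 0 i t - T w i t)
      = \sum_i (a w t * (q%:R * NT w t ^+ q.-1 * 2)) * (T w i t * (T 0 i t - T w i t)).
      by apply: eq_bigr => i _; ring.
    by rewrite -mulr_sumr; ring.
  apply: big1 => v vw; apply: big1 => i _.
  apply: (@mean_null _ _ (p ^ v.+1)); first by rewrite p_gt0.
  apply: null_mul; last by case: (pureF i v).
  apply: (@invariant_dvd R N _ (p ^ w)); rewrite ?dvd_pw ?dvdN ?[(w <= K)%N]ltnW //.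
  have wK : (w <= K)%N by apply: ltnW.
  by move=> t k; rewrite /= inva invNT // invT.
rewrite -[leLHS]addr0 -rest0 -meanD; apply: mean_le => t; rewrite /rest -mulrDr.
apply: ler_wpM2l => //.
apply: le_trans (expr_tangent q (NT0 w t) (NT0 0 t)); rewrite lerD2l.
apply: ler_wpM2l; first by rewrite mulr_ge0 ?ler0n ?exprn_ge0.
rewrite /NT -sumrB mulr_sumr; apply: ler_sum => i _.
have := sqr_ge0 (T 0 i t - T w i t); nra.
Qed.

Let NT_rec (w : 'I_K) t :
  NT w t = a w t + 2 * (\sum_i F i w t * T w.+1 i t) + NT w.+1 t.
Proof.
rewrite /NT /a mulr_sumr -!big_split /=; apply: eq_bigr => i _.
by rewrite T_rec; ring.
Qed.

(** The frequencies of F i w have valuation exactly w, those of the other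
    factors have larger valuation: none of the sums is zero. *)
Let cross0 (w : 'I_K) q :
  mean (fun t => (\sum_i F i w t * T w.+1 i t) * NT w.+1 t ^+ q) = 0.
Proof.
pose g i t := (T w.+1 i t * NT w.+1 t ^+ q) * F i w t.
have -> : mean (fun t => (\sum_i F i w t * T w.+1 i t) * NT w.+1 t ^+ q) = \sum_i mean (g i).
  rewrite -mean_sum; apply: eq_mean => t; rewrite mulr_suml; apply: eq_bigr => i _.
  by rewrite /g; ring.
apply: big1 => i _; apply: (@mean_null _ _ (p ^ w.+1)); first by rewrite p_gt0.
apply: null_mul; last by case: (pureF i w).
by move=> t k; rewrite /= invT // invNT.
Qed.

Let NT_le (w : 'I_K) t : NT w.+1 t <= 2 * a w t + 2 * NT w t.
Proof.
rewrite /NT /a !mulr_sumr -big_split /=; apply: ler_sum => i _.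
rewrite (_ : T w.+1 i t = T w i t - F i w t); last by rewrite T_rec; ring.
have := sqr_ge0 (T w i t + F i w t); lra.
Qed.

(** Passing from the tail w.+1 to the tail w increases the moment by at most a
    multiple of the mean of a w (a w + NT w) ^ q, the cross term being zero;
    Jensen's inequality replaces NT w by NT 0.  Summing over w leaves the
    moment of NT 0 on both sides, once with a small coefficient. *)
Lemma square_function_one_aux (q : nat) (C B : R) : 0 <= C -> B = C * 6 ^+ q ->
  (forall a b c : R, 0 <= a -> 0 <= c -> b ^+ 2 <= a * c ->
  (a + 2 * b + c) ^+ q.+1 <= c ^+ q.+1 + 2 * q.+1%:R * b * c ^+ q + C * a * (a + c) ^+ q) ->
  mean (fun t => (\sum_i (\sum_w F i w t) ^+ 2) ^+ q.+1) <=
  (2 * B * (1 + (2 * B + 2) ^+ q)) * mean (fun t => (\sum_i \sum_w F i w t ^+ 2) ^+ q.+1).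
Proof.
move=> C0 eB HC; have B0 : 0 <= B by rewrite eB mulr_ge0 ?exprn_ge0.
pose S t := \sum_w a w t.
have S0 t : 0 <= S t by apply: sumr_ge0.
have eS t : \sum_i \sum_w F i w t ^+ 2 = S t by rewrite exchange_big.
have eN t : \sum_i (\sum_w F i w t) ^+ 2 = NT 0 t by [].
rewrite (eq_mean (fun t => congr1 (fun x => x ^+ q.+1) (eS t))).
rewrite (eq_mean (fun t => congr1 (fun x => x ^+ q.+1) (eN t))).
have step (w : 'I_K) : mean (fun t => NT w t ^+ q.+1) - mean (fun t => NT w.+1 t ^+ q.+1)
   <= B * (mean (fun t => a w t ^+ q.+1) + mean (fun t => a w t * NT 0 t ^+ q)).
  rewrite lerBlDr addrC.
  apply: (@le_trans _ _ (mean (fun t => NT w.+1 t ^+ q.+1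
     + ((2 * q.+1%:R) * ((\sum_i F i w t * T w.+1 i t) * NT w.+1 t ^+ q)
     + B * (a w t ^+ q.+1 + a w t * NT w t ^+ q))))).
    apply: mean_le => t; rewrite {1}NT_rec.
    apply: le_trans (HC _ _ _ (a0 w t) (NT0 w.+1 t) (cauchy_schwarz _ _)) _.
    rewrite addrA; apply: lerD.
      by rewrite lerD2l le_eqVlt; apply/orP; left; apply/eqP; ring.
    rewrite eB -[C * _ * _]mulrA -[C * _ * _]mulrA; apply: ler_wpM2l => //.
    rewrite exprS -mulrDr mulrCA; apply: ler_wpM2l => //.
    apply: (@le_trans _ _ ((3 * (a w t + NT w t)) ^+ q)); last first.
      rewrite (_ : 6 = 3 * 2 :> R) ?exprMn -?mulrA; last by rewrite -natrM.
      by apply: ler_wpM2l; rewrite ?exprn_ge0 // exprD_le.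
    have := NT_le w t; have := a0 w t; have := NT0 w t; have := NT0 w.+1 t.
    by move=> h1 h2 h3 h4; apply: lerXn2r; rewrite ?nnegrE; lra.
  rewrite meanD meanD meanZ cross0 mulr0 add0r meanZ meanD lerD2l.
  by apply: ler_wpM2l => //; rewrite lerD2l jensen.
have tele : mean (fun t => NT 0 t ^+ q.+1) <=
   B * (mean (fun t => S t ^+ q.+1) + mean (fun t => S t * NT 0 t ^+ q)).
  have -> : mean (fun t => NT 0 t ^+ q.+1) =
    \sum_(w < K) (mean (fun t => NT w t ^+ q.+1) - mean (fun t => NT w.+1 t ^+ q.+1)).
    rewrite -(big_mkord xpredT (fun w => mean (fun t => NT w t ^+ q.+1) - mean (fun t => NT w.+1 t ^+ q.+1))).
    under eq_bigr do rewrite -opprB.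
    rewrite sumrN telescope_sumr // opprB.
    rewrite [X in _ = _ - X](eq_mean (h := fun=> 0)) ?mean_const ?subr0 // => t.
    rewrite /NT big1 ?expr0n // => i _; rewrite /T big1 ?expr0n // => v Kv.
    by move: (ltn_ord v); rewrite ltnNge Kv.
  apply: le_trans (ler_sum _ (fun w _ => step w)) _.
  rewrite -mulr_sumr big_split /=; apply: ler_wpM2l => //.
  rewrite -!mean_sum; apply: lerD; apply: mean_le => t; first exact: sum_pow_le.
  by rewrite -mulr_suml.
have L0 : 0 < 2 * B + 2 by apply: ltr_wpDl; rewrite ?mulr_ge0.
have yg : mean (fun t => S t * NT 0 t ^+ q) <=
  (2 * B + 2) ^+ q * mean (fun t => S t ^+ q.+1) + (2 * B + 2)^-1 * mean (fun t => NT 0 t ^+ q.+1).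
  rewrite -!meanZ -meanD; apply: mean_le => t.
  by rewrite [_^-1 * _]mulrC; apply: young_pow.
set X := mean (fun t => NT 0 t ^+ q.+1) in tele yg *; set Y := mean (fun t => S t ^+ q.+1) in tele yg *.
have X0 : 0 <= X by apply: mean_ge0 => t; apply: exprn_ge0.
have BX : B * ((2 * B + 2)^-1 * X) <= X / 2.
  rewrite mulrA [X / 2]mulrC; apply: ler_wpM2r => //.
  by rewrite ler_pdivrMr //; lra.
have := ler_wpM2l B0 yg; move: tele; rewrite !mulrDr; move: BX.
set Z := (_ + _) ^+ q; set U := _^-1 * X; set V := mean _; lra.
Qed.
End OnePrime.

(** The square function inequality for the decomposition by the valuation at
    one prime, for functions with values in a Euclidean space. *)
Theorem square_function_one (R : realType) (q : nat) : exists2 C : R, 1 <= C &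
  forall (N p K : nat) (I : finType) (F : I -> 'I_K -> 'I_N.+1 -> R),
  (p ^ K %| N.+1)%N -> (forall i (w : 'I_K), pure_at p w (F i w)) ->
  mean (fun t => (\sum_i (\sum_w F i w t) ^+ 2) ^+ q.+1) <=
  C * mean (fun t => (\sum_i \sum_w F i w t ^+ 2) ^+ q.+1).
Proof.
have [C C0 HC] := pow_second_order R q.
set B := C * 6 ^+ q; pose D := 2 * B * (1 + (2 * B + 2) ^+ q).
exists (1 + D).
  rewrite lerDl /D !mulr_ge0 ?exprn_ge0 ?addr_ge0 ?exprn_ge0 ?addr_ge0 ?mulr_ge0 ?exprn_ge0 //.
move=> N p K I F pK pF; apply: le_trans (square_function_one_aux pK pF C0 (erefl _) HC) _.
apply: ler_wpM2r; last by rewrite lerDr.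
apply: mean_ge0 => t; apply: exprn_ge0; apply: sumr_ge0 => i _.
by apply: sumr_ge0 => w _; apply: sqr_ge0.
Qed.

(** The primes are treated one after the other: the inequality for vector
    valued functions lets the level at a prime already treated become part of
    the index of the vector.  At the end every vector component contains at
    most one of the functions, because the levels separate them. *)
Theorem square_function (R : realType) (q r : nat) : exists2 C : R, 1 <= C &
  forall (N K : nat) (ps : seq nat), (size ps <= r)%N ->
  (forall p, p \in ps -> (p ^ K %| N.+1)%N) ->
  forall (I V : finType) (lev : nat -> V -> nat) (P : I -> pred V)
    (F : I -> V -> 'I_N.+1 -> R),
  (forall i v t, ~~ P i v -> F i v t = 0) ->
  (forall p i v, p \in ps -> P i v -> (lev p v < K)%N /\ pure_at p (lev p v) (F i v)) ->
  (forall i v v', P i v -> P i v' -> (forall p, p \in ps -> lev p v = lev p v') -> v = v') ->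
  mean (fun t => (\sum_i (\sum_v F i v t) ^+ 2) ^+ q.+1) <=
  C * mean (fun t => (\sum_i \sum_v F i v t ^+ 2) ^+ q.+1).
Proof.
have [C C1 HC] := square_function_one R q.
have C0 : 0 <= C by apply: le_trans C1.
exists (C ^+ r); first exact: exprn_ege1.
move=> N K ps; elim: ps r => [|p ps IH] r; last case: r => [//|r].
  move=> _ _ I V lev P F F0 _ sep.
  rewrite -[leLHS]mul1r; apply: ler_pM => //.
  - by apply: mean_ge0 => t; apply: exprn_ge0; apply: sumr_ge0 => i _; apply: sqr_ge0.
  - exact: exprn_ege1.
  rewrite le_eqVlt; apply/orP; left; apply/eqP; apply: eq_mean => t.
  congr (_ ^+ _); apply: eq_bigr => i _.
  case: (pickP (P i)) => [v0 Pv0|noP].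
    have z v : v != v0 -> F i v t = 0.
      by move=> vv0; apply: F0; apply: contra vv0 => Pv; apply/eqP; apply: (sep i).
    rewrite (bigD1 v0) //= [X in _ + X]big1; last by move=> v /z.
    rewrite [RHS](bigD1 v0) //= [X in _ = _ + X]big1 ?addr0 //.
    by move=> v /z ->; rewrite expr0n.
  rewrite !big1 ?expr0n // => v _; rewrite F0 ?noP ?expr0n //.
rewrite ltnS => sz pK I V lev P F F0 pF sep.
have pps : p \in p :: ps by rewrite mem_head.
pose G i (w : 'I_K) t := \sum_(v | P i v && (lev p v == w)) F i v t.
pose F' (iw : I * 'I_K) v t := if lev p v == iw.2 then F iw.1 v t else 0.
pose P' (iw : I * 'I_K) v := P iw.1 v && (lev p v == iw.2).
have part (i : I) (f : V -> R) : (forall v, ~~ P i v -> f v = 0) ->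
    \sum_v f v = \sum_(w < K) \sum_(v | P i v && (lev p v == w)) f v.
  move=> f0; rewrite (bigID (P i)) /= [X in _ + X]big1 ?addr0; last by move=> v /f0.
  rewrite (exchange_big_dep (P i)) /=; last by move=> w v _ /andP[].
  apply: eq_bigr => v Pv; have [lt _] := pF p i v pps Pv.
  by rewrite (big_pred1 (Ordinal lt)) // => w; rewrite Pv /= -val_eqE eq_sym.
have sumF' i w t : \sum_v F' (i, w) v t = G i w t.
  rewrite /F' /G /= (bigID (fun v => P i v && (lev p v == w))) /= [X in _ + X]big1 ?addr0.
    by apply: eq_bigr => v /andP[_ ->].
  by move=> v; case: ifP => // _; rewrite andbT => /F0.
have step1 := HC N p K I G (pK p pps) _.
have eL t : \sum_i (\sum_v F i v t) ^+ 2 = \sum_i (\sum_w G i w t) ^+ 2.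
  by apply: eq_bigr => i _; rewrite (part i) // => v /F0.
rewrite (eq_mean (fun t => congr1 (fun x => x ^+ q.+1) (eL t))).
apply: le_trans (step1 _) _.
  move=> i w; split.
    by apply: invariant_sum => v /andP[Pv /eqP <-]; case: (pF p i v pps Pv) => _ [].
  by apply: null_sum => v /andP[Pv /eqP <-]; case: (pF p i v pps Pv) => _ [].
rewrite exprS -mulrA; apply: ler_wpM2l => //.
have eM t : \sum_i \sum_w G i w t ^+ 2 = \sum_iw (\sum_v F' iw v t) ^+ 2.
  by rewrite pair_big /=; apply: eq_bigr => -[i w] _; rewrite sumF'.
have eR t : \sum_i \sum_v F i v t ^+ 2 = \sum_iw \sum_v F' iw v t ^+ 2.
  rewrite -(pair_big xpredT xpredT (fun i w => \sum_v F' (i, w) v t ^+ 2)) /=.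
  apply: eq_bigr => i _; rewrite (part i) => [|v /F0 ->]; last by rewrite expr0n.
  apply: eq_bigr => w _; rewrite [RHS](bigID (fun v => P i v && (lev p v == w))) /=.
  rewrite [X in _ = _ + X]big1 ?addr0.
    by apply: eq_bigr => v /andP[_ e]; rewrite /F' /= e.
  by move=> v; rewrite /F' /=; case: ifP => [_|]; rewrite ?andbT ?expr0n // => /F0 ->; rewrite expr0n.
rewrite (eq_mean (fun t => congr1 (fun x => x ^+ q.+1) (eM t))).
rewrite (eq_mean (fun t => congr1 (fun x => x ^+ q.+1) (eR t))).
apply: (IH r sz _ _ _ lev P').
- by move=> p' p'ps; apply: pK; rewrite inE p'ps orbT.
- move=> [i w] v t; rewrite /P' /F' /=; case: ifP => // _; rewrite andbT; exact: F0.
- move=> p' [i w] v p'ps; rewrite /P' /= => /andP[Pv /eqP e].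
  have [|lt pu] := pF p' i v _ Pv; first by rewrite inE p'ps orbT.
  split=> //; rewrite /F' /= e eqxx.
  by case: pu => h1 h2; split => [t k|t]; [exact: h1 | exact: h2].
- move=> [i w] v v' /andP[/= Pv /eqP e] /andP[/= Pv' /eqP e'] H.
  apply: (sep i) => // p'; rewrite inE => /orP[/eqP ->|]; last exact: H.
  by rewrite e e'.
Qed.

(** * Cosine sums sorted by their smooth parts *)

Lemma reindex_scale (V : nmodType) (X Y u : nat) (A : pred nat) (G : nat -> V) :
  (0 < u)%N -> (forall v, A v -> (v < X)%N /\ (v * u < Y)%N) ->
  \sum_(w < Y | (u %| w)%N && A (w %/ u)%N) G w = \sum_(v < X | A v) G (v * u)%N.
Proof.
move=> u0 HA.
have -> : \sum_(v < X | A v) G (v * u)%N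
    = \sum_(v < X | A v) \sum_(w < Y | (w == v * u :> nat)%N) G w.
  apply: eq_bigr => v Av; have [_ lt] := HA _ Av.
  by rewrite (big_pred1 (Ordinal lt)).
rewrite (exchange_big_dep (fun w : 'I_Y => (u %| w)%N && A (w %/ u)%N)) /=; last first.
  by move=> v w Av /eqP ->; rewrite dvdn_mull // mulnK.
apply: eq_bigr => w /andP[uw Aw]; have [lt _] := HA _ Aw.
rewrite (big_pred1 (Ordinal lt)) // => v /=; rewrite -val_eqE /=.
apply/andP/eqP => [[_ /eqP ->]|->]; first by rewrite mulnK.
by rewrite divnK.
Qed.

Section Systems.
Variable ps : seq nat.
Hypothesis prime_ps : all prime ps.

Definition in_ps : nat_pred := [pred p | p \in ps].

Definition smooth_part (y : int) : nat := (`|y|%N)`_in_ps%N.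
(** The factor of y prime to ps, with the sign of y. *)
Definition core (y : int) : int := sgz y * ((`|y|%N)`_in_ps^')%N%:Z.

Lemma core_smooth y : (smooth_part y)%:Z * core y = y.
Proof.
have [->|y0] := eqVneq y 0; first by rewrite /core sgz0 mul0r mulr0.
rewrite mulrCA -PoszM partnC ?absz_gt0 //; by rewrite -intEsg.
Qed.

Lemma smooth_part_gt0 y : (0 < smooth_part y)%N.
Proof. exact: part_gt0. Qed.

Lemma abs_core y : y != 0 -> `|core y|%N = ((`|y|%N)`_in_ps^')%N.
Proof.
move=> y0; rewrite /core; case: (ltgtP y 0) y0 => // [yn|yp] _.
  by rewrite ltr0_sgz // mulN1r abszN.
by rewrite gtr0_sgz // mul1r.
Qed.

Lemma core_coprime y p : y != 0 -> p \in ps -> ~~ (p %| `|core y|)%N.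
Proof.
move=> y0 pps; have pp : prime p by apply: (allP prime_ps).
rewrite abs_core //; apply/negP => pd.
have := part_pnat in_ps^' `|y|%N => /pnatP -/(_ (part_gt0 _ _)) /(_ p pp pd).
by rewrite inE /= inE pps.
Qed.

(** Encodes the cosine sum whose frequencies are v * z x with x in T and v in
    W x: here v is the part of the frequency composed of primes in ps and z x
    is the part prime to ps.  The encoding keeps pairs (x, v) instead of
    frequencies because an index x meets every v at most once; so m bounds
    the number of frequencies per index, and it does not grow when the sum is
    squared. *)
Definition system (m X : nat) (T : finType) (z : T -> int) (W : T -> pred nat) : Prop :=
  [/\ (0 < #|T|)%N,
      forall x v, W x v -> [/\ in_ps.-nat v, forall p, p \in ps -> ~~ (p %| `|z x|)%N
                             & (0 < v * `|z x| < X)%N]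
    & forall x, (\sum_(v < X | W x v) 1 <= m)%N].

Section Next.
Variables (T : finType) (z : T -> int) (W : T -> pred nat).

(** The product of two terms with the same v contains the frequencies
    v * (z x - z y) and v * (z x + z y); the boolean selects one of them. *)
Definition pairing (x : T * T * bool) : int :=
  if x.2 then z x.1.1 + z x.1.2 else z x.1.1 - z x.1.2.
Definition next_z (x : T * T * bool) : int := core (pairing x).
(** Pairs with a vanishing frequency are discarded: they contribute to the
    mean value only. *)
Definition next_W (x : T * T * bool) : pred nat := fun v =>
  (pairing x != 0) && ((smooth_part (pairing x) %| v)%N &&
     (W x.1.1 (v %/ smooth_part (pairing x))%N && W x.1.2 (v %/ smooth_part (pairing x))%N)).

Lemma pairing_abs x : (`|pairing x| <= `|z x.1.1| + `|z x.1.2|)%N.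
Proof. by clear prime_ps; rewrite /pairing; case: x.2; lia. Qed.

Variables (m X : nat).
Hypothesis sys : system m X z W.

Lemma system_lt x v : W x v -> (0 < v < X)%N.
Proof.
case: sys => _ H _ /H [_ _ /andP[]]; rewrite muln_gt0 => /andP[v0 z0] lt.
by rewrite v0; apply: leq_ltn_trans lt; apply: leq_pmulr.
Qed.

Lemma next_bound x v : W x.1.1 v -> W x.1.2 v -> (v * `|pairing x| < X.*2)%N.
Proof.
case: sys => _ H _ /H [_ _ /andP[_ h1]] /H [_ _ /andP[_ h2]].
apply: (@leq_ltn_trans (v * `|z x.1.1| + v * `|z x.1.2|)).
  by rewrite -mulnDr leq_mul2l pairing_abs orbT.
rewrite -addnn -addSn; apply: leq_add => //; exact: ltnW.
Qed.

Lemma next_scale x v : pairing x != 0 -> W x.1.1 v && W x.1.2 v ->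
  (v < X)%N /\ (v * smooth_part (pairing x) < X.*2)%N.
Proof.
move=> y0 /andP[w1 w2]; split; first by case/andP: (system_lt w1).
apply: leq_ltn_trans (next_bound w1 w2); rewrite leq_mul2l dvdn_leq ?orbT ?absz_gt0 //.
exact: dvdn_part.
Qed.

Lemma next_system : system m X.*2 next_z next_W.
Proof.
case: (sys) => T0 H Hm; split.
- by rewrite !card_prod card_bool !muln_gt0 T0.
- move=> x v /andP[y0 /andP[uv /andP[w1 w2]]].
  set u := smooth_part _ in uv w1 w2.
  have [s1 _ _] := H _ _ w1.
  have ev : v = (v %/ u * u)%N by rewrite divnK.
  split.
  + by rewrite ev pnatM s1 part_pnat.
  + by move=> p pps; apply: core_coprime.
  + have [/andP[v0 _]] := system_lt w1.
    rewrite {1 2}ev abs_core // -mulnA partnC ?absz_gt0 // next_bound // andbT.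
    by rewrite muln_gt0 v0 absz_gt0.
- move=> x; rewrite /next_W; have [y0|y0] := eqVneq (pairing x) 0.
    by rewrite big_pred0.
  rewrite (reindex_scale (A := fun v => W x.1.1 v && W x.1.2 v) (fun=> 1%N)
     (smooth_part_gt0 _) (fun v => next_scale y0)).
  apply: leq_trans (Hm x.1.1); rewrite [leqRHS](bigID (fun v : 'I_X => W x.1.2 v)) /=.
  exact: leq_addr.
Qed.

End Next.
End Systems.

Section PureClosure.
Variables (R : realType) (N p w : nat).

Lemma pure_sum (I : finType) (P : pred I) (h : I -> 'I_N.+1 -> R) :
  (forall i, P i -> pure_at p w (h i)) -> pure_at p w (fun t => \sum_(i | P i) h i t).
Proof.
move=> H; split; first by apply: invariant_sum => i /H [].
by apply: null_sum => i /H [].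
Qed.

Lemma pure_scale (c : R) (h : 'I_N.+1 -> R) :
  (c != 0 -> pure_at p w h) -> pure_at p w (fun t => c * h t).
Proof.
have [->|c0 /(_ isT) [H1 H2]] := eqVneq c 0.
  move=> _; split => [t k|t]; first by rewrite !mul0r.
  by rewrite big1 // => k _; rewrite mul0r.
split => [t k|t]; first by rewrite H1.
by rewrite -mulr_sumr H2 mulr0.
Qed.

Lemma pure_chi x : prime p -> (p ^ w.+1 %| N.+1)%N -> x != 0 ->
  logn p `|x|%N = w -> pure_at p w (@chi R N x).
Proof.
move=> pp + x0 wE; rewrite -wE => dN.
have ax0 : (0 < `|x|)%N by rewrite absz_gt0.
split.
  apply: invariant_chi; last by rewrite dvdzE; apply: pfactor_dvdnn.
  by apply: dvdn_trans dN; rewrite dvdn_exp2l.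
by apply: null_chi => //; rewrite dvdzE /= pfactor_dvdn // ltnn.
Qed.
End PureClosure.

Section SystemFunctions.
Variables (R : realType) (N : nat) (T : finType) (z : T -> int) (W : T -> pred nat).

(** Scaled by the number of indices, so that its coefficients add up to at
    most 1. *)
Definition component (v : nat) (t : 'I_N.+1) : R :=
  (\sum_x (W x v)%:R * chi R (v%:Z * z x) t) / #|T|%:R.

Definition square_sum (X : nat) (t : 'I_N.+1) : R := \sum_(v < X) component v t ^+ 2.

Lemma square_sum_ge0 X t : 0 <= square_sum X t.
Proof. by apply: sumr_ge0 => v _; apply: sqr_ge0. Qed.

(** A component is at most the proportion mass v of indices that meet v, which
    is at most 1, and these proportions add up to at most m. *)
Lemma square_sum_le ps m X t : system ps m X z W -> square_sum X t <= m%:R.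
Proof.
case=> T0 _ Hm; have T0R : 0 < #|T|%:R :> R by rewrite ltr0n.
pose mass v : R := (\sum_x (W x v)%:R) / #|T|%:R.
have mass0 v : 0 <= mass v by rewrite divr_ge0 ?ler0n // sumr_ge0 // => x _; rewrite ler0n.
have mass1 v : mass v <= 1.
  rewrite ler_pdivrMr // mul1r -natr_sum ler_nat -sum1_card; apply: leq_sum => x _.
  by case: (W x v).
have cm v : `|component v t| <= mass v.
  rewrite /component /mass normrM [ `|_^-1|]ger0_norm ?invr_ge0 ?ler0n //.
  apply: ler_wpM2r; rewrite ?invr_ge0 ?ler0n //.
  apply: le_trans (ler_norm_sum _ _ _) _; apply: ler_sum => x _.
  by rewrite normrM ger0_norm ?ler0n // ler_piMr ?ler0n // chi_le1.
apply: (@le_trans _ _ (\sum_(v < X) mass v)).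
  apply: ler_sum => v _; rewrite -real_normK ?num_real // expr2.
  apply: (@le_trans _ _ (mass v * mass v)); first exact: ler_pM.
  by rewrite ler_piMr.
rewrite -mulr_suml ler_pdivrMr // exchange_big /=.
apply: (@le_trans _ _ (\sum_(x : T) m%:R)); last by rewrite sumr_const mulr_natr.
apply: ler_sum => x _; rewrite -natr_sum ler_nat; apply: leq_trans (Hm x).
by rewrite [leqRHS]big_mkcond; apply: leq_sum => v _; case: (W x v).
Qed.

Lemma mean_component_mul_ge0 v v' : 0 <= mean (fun t => component v t * component v' t).
Proof.
rewrite (_ : (fun t => _) = fun t => (#|T|%:R ^-1 ^+ 2) *
   \sum_x \sum_y ((W x v)%:R * (W y v')%:R) * (chi R (v%:Z * z x) t * chi R (v'%:Z * z y) t)).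
  rewrite meanZ mulr_ge0 ?exprn_ge0 ?invr_ge0 ?ler0n // mean_sum sumr_ge0 // => x _.
  rewrite mean_sum sumr_ge0 // => y _; rewrite meanZ.
  by apply: mulr_ge0; [rewrite mulr_ge0 ?ler0n | apply: mean_chi2_ge0].
apply/funext => t; rewrite /component mulrACA mulrC expr2; congr (_ * _).
rewrite mulr_suml; apply: eq_bigr => x _; rewrite mulr_sumr; apply: eq_bigr => y _; ring.
Qed.

(** The mixed terms of the square have nonnegative mean. *)
Lemma mean_square_sum_le X :
  mean (square_sum X) <= mean (fun t => (\sum_(v < X) component v t) ^+ 2).
Proof.
rewrite (_ : (fun t => (\sum_(v < X) component v t) ^+ 2)
   = fun t => square_sum X t + \sum_(v < X) \sum_(v' < X | v' != v) component v t * component v' t).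
  rewrite meanD lerDl mean_sum sumr_ge0 // => v _.
  by rewrite mean_sum sumr_ge0 // => v' _; apply: mean_component_mul_ge0.
apply/funext => t; rewrite expr2 mulr_suml -big_split /=; apply: eq_bigr => v _.
by rewrite mulr_sumr (bigD1 v) //= expr2.
Qed.

End SystemFunctions.

Section SystemRecursion.
Variables (R : realType) (N : nat) (ps : seq nat) (T : finType) (z : T -> int) (W : T -> pred nat).
Variables (m X : nat).
Hypothesis prime_ps : all prime ps.
Hypothesis sys : system ps m X z W.
Hypothesis XN : (X.*2 <= N.+1)%N.

Let z' := next_z ps z.
Let W' := next_W ps z W.

Lemma mean_next_component v : mean (component R (N := N) z' W' v) = 0.
Proof.
have [T0' H _] := next_system prime_ps sys.
rewrite (_ : component _ _ _ _ = fun t => #|{: T * T * bool}|%:R^-1 *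
    \sum_x (W' x v)%:R * chi R (v%:Z * z' x) t); last first.
  by apply/funext => t; rewrite mulrC.
rewrite meanZ mean_sum big1 ?mulr0 // => x _; rewrite meanZ.
have [Wx|] := boolP (W' x v); last by rewrite mul0r.
rewrite mean_chi_eq0 ?mulr0 //.
have [_ _ /andP[h1 h2]] := H _ _ Wx.
apply/negP; rewrite dvdzE /= abszM /= => /(dvdn_leq h1).
by rewrite leqNgt (leq_trans h2).
Qed.

(** The engine of the induction: up to its mean, the sum of the squares of the
    components is the cosine sum of another system. *)
Lemma square_sum_next t : square_sum R z W X t =
  mean (square_sum R z W X (N := N)) + \sum_(v < X.*2) component R (N := N) z' W' v t.
Proof.
have [T0 H _] := sys; have T0R : #|T|%:R != 0 :> R by rewrite pnatr_eq0 -lt0n.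
pose D : R := #|{: T * T * bool}|%:R^-1.
pose Y (x : T * T * bool) (t : 'I_N.+1) := \sum_(v < X | W x.1.1 v && W x.1.2 v) chi R (v%:Z * pairing z x) t.
have eQ s : square_sum R z W X s = D * \sum_x Y x s :> R.
  have eD : D = #|T|%:R^-1 ^+ 2 / 2.
    by rewrite /D !card_prod card_bool !natrM; field.
  rewrite /square_sum /Y eD.
  have -> : \sum_x \sum_(v < X | W x.1.1 v && W x.1.2 v) chi R (v%:Z * pairing z x) s
      = \sum_(v < X) \sum_x ((W x.1.1 v)%:R * (W x.1.2 v)%:R) * chi R (v%:Z * pairing z x) s.
    rewrite exchange_big /=; apply: eq_bigr => x _; rewrite big_mkcond.
    by apply: eq_bigr => v _; case: (W _ v); case: (W _ v); rewrite ?mul1r ?mul0r ?mulr0.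
  rewrite mulr_sumr; apply: eq_bigr => v _.
  rewrite /component exprMn [LHS]mulrC -[RHS]mulrA; congr (_ * _).
  pose f x := ((W x.1.1 v)%:R * (W x.1.2 v)%:R) * chi R (v%:Z * pairing z x) s.
  rewrite [X in _ = _ * X](_ : _ = \sum_x \sum_y \sum_b f (x, y, b)); last first.
    by rewrite pair_bigA /= pair_bigA /=; apply: eq_bigr => -[[x y] b] _.
  rewrite expr2 mulr_suml mulr_sumr; apply: eq_bigr => x _.
  rewrite !mulr_sumr; apply: eq_bigr => y _.
  rewrite big_bool /f /pairing /= mulrBr [v%:Z * (z x + z y)]mulrDr mulrACA chiM; ring.
pose kap : R := D * \sum_(x | pairing z x == 0) Y x t.
have Y0 x s : pairing z x == 0 -> Y x s = Y x t.
  by move=> /eqP y0; apply: eq_bigr => v _; rewrite y0 mulr0 !chi0.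
have Y1 x s : pairing z x != 0 ->
    Y x s = \sum_(v < X.*2) (W' x v)%:R * chi R (v%:Z * z' x) s.
  move=> y0; rewrite /Y.
  have := reindex_scale (A := fun v => W x.1.1 v && W x.1.2 v)
    (fun v => chi R (v%:Z * z' x) s) (smooth_part_gt0 ps (pairing z x))
    (fun v => next_scale sys y0).
  under [in X in _ = X]eq_bigr => v _ do rewrite PoszM -mulrA core_smooth.
  move=> <-; rewrite big_mkcond; apply: eq_bigr => v _.
  by rewrite /W' /next_W y0 /=; case: ifP => _; rewrite ?mul1r ?mul0r.
have key s : square_sum R z W X s = kap + \sum_(v < X.*2) component R (N := N) z' W' v s.
  rewrite eQ (bigID (fun x => pairing z x == 0)) /= mulrDr; congr (_ + _).
    by congr (_ * _); apply: eq_bigr => x /Y0.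
  under [RHS]eq_bigr => v _ do rewrite /component mulrC.
  rewrite -mulr_sumr exchange_big /=; congr (_ * _).
  rewrite [RHS](bigID (fun x => pairing z x == 0)) /= [X in _ = X + _]big1 ?add0r.
    by apply: eq_bigr => x /Y1.
  by move=> x y0; rewrite big1 // => v _; rewrite /W' /next_W y0 mul0r.
have -> : mean (square_sum R z W X (N := N)) = kap.
  rewrite (eq_mean key) meanD mean_const mean_sum big1 ?addr0 // => v _.
  exact: mean_next_component.
exact: key.
Qed.
End SystemRecursion.

(** The component v has valuation logn p v at every prime p of ps, and v is
    determined by these valuations, being a product of primes of ps. *)
Theorem square_function_system (R : realType) (q r : nat) : exists2 C : R, 1 <= C &
  forall (N K m X : nat) (ps : seq nat), (size ps <= r)%N -> all prime ps ->
  (forall p, p \in ps -> (p ^ K %| N.+1)%N) -> (X <= 2 ^ K)%N ->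
  forall (T : finType) (z : T -> int) (W : T -> pred nat), system ps m X z W ->
  mean (fun t => (\sum_(v < X) component R (N := N) z W v t) ^+ q.+1.*2) <=
  C * mean (fun t => square_sum R (N := N) z W X t ^+ q.+1).
Proof.
have [C C1 HC] := square_function R q r; exists C => //.
move=> N K m X ps sz pps pK XK T z W sys.
have [T0 H _] := sys.
pose P (_ : unit) (v : 'I_X) := [exists x, W x v].
have := HC N K ps sz pK unit 'I_X (fun p v => logn p v) P
  (fun _ v => component R (N := N) z W v).
rewrite (eq_mean (h := fun t => (\sum_(v < X) component R (N := N) z W v t) ^+ q.+1.*2)); last first.
  by move=> t; rewrite big_const card_unit /= addr0 -exprM mul2n.
rewrite (eq_mean (g := fun t => (\sum_(i : unit) _) ^+ _)
                 (h := fun t => square_sum R z W X t ^+ q.+1)); last first.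
  by move=> t; rewrite big_const card_unit /= addr0.
apply.
- move=> _ v t /existsPn nW; rewrite /component big1 ?mul0r // => x _.
  by rewrite (negbTE (nW x)) mul0r.
- move=> p _ v pin /existsP[x0 Wx0]; have pp : prime p by apply: (allP pps).
  have /andP[v0 vX] := system_lt sys Wx0.
  have lt : (logn p v < K)%N.
    rewrite -(ltn_exp2l _ _ (prime_gt1 pp)); apply: (@leq_ltn_trans v).
      by apply: dvdn_leq => //; apply: pfactor_dvdnn.
    apply: leq_trans vX (leq_trans XK _).
    by case: (K) => // K'; rewrite leq_exp2r // prime_gt1.
  split=> //.
  rewrite (_ : component _ _ _ _ = fun t => #|T|%:R^-1 * \sum_x (W x v)%:R * chi R (v%:Z * z x) t); last first.
    by apply/funext => t; rewrite mulrC.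
  apply: pure_scale => _; apply: pure_sum => x _; apply: pure_scale.
  case Wx: (W x v); rewrite ?eqxx // => _.
  have [_ cop /andP[vz0 _]] := H _ _ Wx.
  have z0 : (0 < `|z x|)%N by move: vz0; rewrite muln_gt0 => /andP[].
  apply: pure_chi => //.
  + by apply: dvdn_trans (pK p pin); rewrite dvdn_exp2l.
  + by rewrite -absz_gt0 abszM.
  + rewrite abszM lognM // [X in (_ + X)%N](_ : _ = 0%N) ?addn0 //.
    by apply/eqP; rewrite lognE pp z0 (negbTE (cop _ pin)).
- move=> _ v v' /existsP[x Wx] /existsP[x' Wx'] e.
  have [s _ /andP[]] := H _ _ Wx; rewrite muln_gt0 => /andP[v0 _] _.
  have [s' _ /andP[]] := H _ _ Wx'; rewrite muln_gt0 => /andP[v0' _] _.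
  apply: val_inj; apply: eqn_from_log => // p.
  have [pin|npin] := boolP (p \in ps); first exact: e.
  have nl u : (in_ps ps).-nat u -> logn p u = 0%N.
    move=> su; apply/eqP; rewrite -leqn0 leqNgt logn_gt0 mem_primes.
    apply: contra npin => /and3P[pp u0 pu].
    by move/pnatP: su => /(_ u0 p pp pu).
  by rewrite !nl.
Qed.

(** * Bootstrapping the high moments *)

Lemma nth_root (R : realType) (A : R) (n : nat) : (0 < n)%N -> 0 <= A ->
  exists2 s : R, 0 <= s & s ^+ n = A.
Proof.
move=> n0 A0; exists (A `^ n%:R^-1); first exact: powR_ge0.
rewrite -powR_mulrn ?powR_ge0 // -powRrM mulVf ?powRr1 // pnatr_eq0 -lt0n //.
Qed.

Lemma exprD_ge (R : realType) (x y : R) (n : nat) : 0 <= x -> 0 <= y ->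
  x ^+ n.+1 + y ^+ n.+1 <= (x + y) ^+ n.+1.
Proof.
move=> x0 y0; rewrite [leRHS]exprS mulrDl !exprS; apply: lerD.
  by apply: ler_wpM2l => //; apply: lerXn2r; rewrite ?nnegrE ?addr_ge0 // lerDl.
by apply: ler_wpM2l => //; apply: lerXn2r; rewrite ?nnegrE ?addr_ge0 // lerDr.
Qed.

(** Splits according to whether Q is below or above the level l; used with l
    slightly above the norm of Q in a high L^p. *)
Lemma mean_sqr_interpolate (R : realType) (N p : nat) (Q : 'I_N.+1 -> R) (l : R) :
  (forall t, 0 <= Q t) -> 0 < l ->
  mean (fun t => Q t ^+ 2) <= l * mean Q + mean (fun t => Q t ^+ p.+2) / l ^+ p.
Proof.
move=> Q0 l0; rewrite [X in _ + X]mulrC -!meanZ -meanD.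
apply: mean_le => t.
have lp : 0 < l ^+ p by apply: exprn_gt0.
have [le|/ltW le] := leP (Q t) l.
  apply: ler_wpDr; first by apply: mulr_ge0; [rewrite invr_ge0 ltW | apply: exprn_ge0].
  by rewrite expr2; apply: ler_wpM2r.
apply: ler_wpDl; first by apply: mulr_ge0 => //; apply: ltW.
rewrite mulrC ler_pdivlMr // -[p.+2]add2n exprD.
apply: ler_wpM2l; rewrite ?exprn_ge0 //.
by apply: lerXn2r; rewrite ?nnegrE // ltW.
Qed.

Lemma mean_centered_sqr_le (R : realType) (N : nat) (Q : 'I_N.+1 -> R) :
  mean (fun t => (Q t - mean Q) ^+ 2) <= mean (fun t => Q t ^+ 2).
Proof.
rewrite (_ : (fun t => (Q t - mean Q) ^+ 2) =
  fun t => Q t ^+ 2 + (- (2 * mean Q) * Q t + mean Q ^+ 2)); last by apply/funext => t; ring.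
rewrite meanD meanD meanZ mean_const -[leRHS]addr0 lerD2l.
have := sqr_ge0 (mean Q); lra.
Qed.

(** Solves the inequality s <= 2 (Z + C y) for s when y^2 contains s itself:
    the mixed term 2 s a is split by the inequality of the arithmetic and the
    geometric mean, with weights such that only s / 2 remains. *)
Lemma bootstrap_step (R : realType) (s y a x c C Z : R) : 0 <= s -> 0 <= y -> 1 <= a ->
  0 <= x -> 1 <= c -> 1 <= C -> Z <= a ->
  y ^+ 2 <= c * (a + 2 * s * a + x ^+ 2) -> s <= 2 * (Z + C * y) ->
  s <= (4 + 16 * c * C ^+ 2) * (a + x).
Proof.
move=> s0 y0 a1 x0 c1 C1 Za hy hs.
have C0 : 0 < C by lra.
have a0 : 0 <= a by lra. have c0 : 0 <= c by lra. have C0' := ltW C0.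
pose K := 4 * c * C.
have K0 : 0 <= K by rewrite /K !mulr_ge0.
have iC0 : 0 <= s / (4 * C) by rewrite divr_ge0 ?mulr_ge0.
(* The constant K makes the mixed term of the square equal to 2 c s (a + x),
   and its square exceeds c. *)
have yle : y <= s / (4 * C) + K * (a + x).
  have r0 : 0 <= s / (4 * C) + K * (a + x) by rewrite addr_ge0 // mulr_ge0 ?addr_ge0.
  rewrite -ler_sqr ?nnegrE //; apply: le_trans hy _.
  have -> : (s / (4 * C) + K * (a + x)) ^+ 2 =
     (s / (4 * C)) ^+ 2 + 2 * c * s * a + 2 * c * s * x + K ^+ 2 * (a + x) ^+ 2.
    rewrite /K; field; lra.
  have h1 : 0 <= (s / (4 * C)) ^+ 2 by apply: sqr_ge0.
  have h2 : 0 <= 2 * c * s * x by rewrite !mulr_ge0.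
  have h3 : c <= K ^+ 2.
    have : c * 1 <= c * (16 * c * C ^+ 2).
      apply: ler_wpM2l => //.
      have cC : 1 * 1 <= c * C ^+ 2 by apply: ler_pM => //; rewrite exprn_ege1.
      lra.
    by rewrite mulr1 /K => /le_trans; apply; rewrite le_eqVlt; apply/orP; left; apply/eqP; ring.
  have h4 : a + x ^+ 2 <= (a + x) ^+ 2.
    have : a * 1 <= a * a by apply: ler_wpM2l.
    have : 0 <= a * x by rewrite mulr_ge0.
    rewrite !expr2; lra.
  have h5 : c * (a + x ^+ 2) <= K ^+ 2 * (a + x) ^+ 2.
    by apply: ler_pM => //; rewrite addr_ge0 ?sqr_ge0.
  rewrite -subr_ge0 in h5; lra.
have Cy : 2 * C * y <= s / 2 + 8 * c * C ^+ 2 * (a + x).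
  have := ler_wpM2l (_ : 0 <= 2 * C) yle; rewrite mulr_ge0 // => /(_ isT) /le_trans; apply.
  rewrite le_eqVlt; apply/orP; left; apply/eqP; rewrite /K; field; lra.
have : 0 <= c * C ^+ 2 * (a + x) by rewrite !mulr_ge0 ?addr_ge0 ?exprn_ge0.
have e : (4 + 16 * c * C ^+ 2) * (a + x) = 4 * a + 4 * x + 16 * (c * C ^+ 2 * (a + x)) by ring.
rewrite e; move: Cy; rewrite (_ : 8 * c * C ^+ 2 * (a + x) = 8 * (c * C ^+ 2 * (a + x))); last by ring.
set U := c * _ * _; move: hs; rewrite mulrDr mulrA; set V := 2 * C * y; lra.
Qed.

(** Exponents of m are written as powers of t, where t ^ (2 ^ H) is at least
    m, to avoid real exponents.  Level j reaches the exponent 2 ^ (H - j) of t in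
    the second term at the price of one more factor t in the first term, and
    at the price of doubling the exponent of the moment.  The moments start at
    2 ^ H.+1, so that the interpolation costs only one factor t. *)
Theorem moment_bound (R : realType) (r H j : nat) : (j <= H)%N -> exists2 C : R, 1 <= C &
  forall (N K m X : nat) (ps : seq nat) (t : R), (size ps <= r)%N -> all prime ps ->
  (forall p, p \in ps -> (p ^ K %| N.+1)%N) ->
  (X * 2 ^ j <= 2 ^ K)%N -> (X * 2 ^ j.+1 <= N.+1)%N -> 1 <= t -> m%:R <= t ^+ (2 ^ H) ->
  forall (T : finType) (z : T -> int) (W : T -> pred nat), system ps m X z W ->
  mean (fun u => square_sum R (N := N) z W X u ^+ (2 ^ (H + j).+1)) <=
  (C * (t ^+ j * Num.max 1 (mean (square_sum R (N := N) z W X)) + t ^+ (2 ^ (H - j))))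
    ^+ (2 ^ (H + j).+1).
Proof.
elim: j => [|j IH] jH.
  exists 1 => // N K m X ps t _ _ _ _ _ t1 mt T z W sys.
  rewrite -[leRHS](mean_const N); apply: mean_le => u.
  have Z0 : 1 <= Num.max 1 (mean (square_sum R (N := N) z W X)) by rewrite le_max lexx.
  apply: lerXn2r.
  - exact: square_sum_ge0.
  - by rewrite nnegrE mul1r addr_ge0 ?mulr_ge0 ?exprn_ge0 //; lra.
  rewrite mul1r expr0 mul1r subn0; apply: le_trans (square_sum_le R u sys) _.
  by apply: le_trans mt _; rewrite lerDr; lra.
have [c c1 Hc] := IH (ltnW jH).
have [n nE] : exists n, (2 ^ (H + j).+1)%N = n by eexists.
have n0 : (0 < n)%N by rewrite -nE expn_gt0.
have Hn : (2 ^ H * 2 <= n)%N by rewrite mulnC -expnS -nE leq_exp2l // ltnS leq_addr.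
rewrite nE in Hc.
have [C C1 HC] := square_function_system R n.-1 r.
exists (4 + 16 * c * C ^+ 2).
  have : 0 <= c * C ^+ 2 by rewrite mulr_ge0 ?exprn_ge0 //; lra.
  rewrite -mulrA; lra.
move=> N K m X ps t sz pps pK XK XN t1 mt T z W sys.
set Q := square_sum R (N := N) z W X; set Z := mean Q; set Zp := Num.max 1 Z.
have t0 : 0 < t by lra.
have Q0 u : 0 <= Q u by apply: square_sum_ge0.
have Z0 : 0 <= Z by apply: mean_ge0.
have Zp1 : 1 <= Zp by rewrite le_max lexx.
have ZZp : Z <= Zp by rewrite le_max lexx orbT.
have -> : (2 ^ (H + j.+1).+1 = n.*2)%N by rewrite addnS expnS nE mul2n.
pose z' := next_z ps z; pose W' := next_W ps z W.
have sys' : system ps m X.*2 z' W' by apply: next_system.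
have XN2 : (X.*2 <= N.+1)%N.
  apply: leq_trans XN; rewrite -muln2 leq_mul2l; apply/orP; right.
  by rewrite expnS leq_pmulr // expn_gt0.
pose Q' := square_sum R (N := N) z' W' X.*2; pose Z' := mean Q'.
pose G u := \sum_(v < X.*2) component R (N := N) z' W' v u.
have QG u : Q u = Z + G u by apply: square_sum_next pps sys XN2 u.
have Hnext := Hc N K m X.*2 ps t sz pps pK.
have {Hnext} bQ' : mean (fun u => Q' u ^+ n) <=
   (c * (t ^+ j * Num.max 1 Z' + t ^+ (2 ^ (H - j)))) ^+ n.
  apply: (Hc N K m X.*2 ps t sz pps pK _ _ t1 mt _ z' W' sys').
  - by move: XK; rewrite -muln2 expnS mulnA.
  - by move: XN; rewrite -muln2 [(2 ^ j.+2)%N]expnS mulnA.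
have bG : mean (fun u => G u ^+ n.*2) <= C * mean (fun u => Q' u ^+ n).
  have := HC N K m X.*2 ps sz pps pK _ _ z' W' sys'; rewrite prednK //; apply.
  apply: leq_trans XK; rewrite -muln2 leq_mul2l expnS.
  by apply/orP; right; rewrite leq_pmulr // expn_gt0.
have Z'le : Z' <= mean (fun u => Q u ^+ 2).
  apply: le_trans (mean_square_sum_le R N z' W' X.*2) _.
  apply: le_trans (mean_centered_sqr_le Q); apply: mean_le => u.
  by rewrite -/(G u) QG -/Z addrC addKr.
have A0 : 0 <= mean (fun u => Q u ^+ n.*2) by apply: mean_ge0 => u; apply: exprn_ge0.
have nn0 : (0 < n.*2)%N by rewrite double_gt0.
have [s s0 sA] := nth_root nn0 A0.
have rhs0 : 0 <= (4 + 16 * c * C ^+ 2) * (t ^+ j.+1 * Zp + t ^+ (2 ^ (H - j.+1))).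
  apply: mulr_ge0; first by apply: addr_ge0 => //; apply: mulr_ge0; [lra | apply: sqr_ge0].
  by apply: addr_ge0; [apply: mulr_ge0; [apply/exprn_ge0/ltW | lra] | apply/exprn_ge0/ltW].
rewrite -sA; suff sle : s <= (4 + 16 * c * C ^+ 2) * (t ^+ j.+1 * Zp + t ^+ (2 ^ (H - j.+1))).
  by apply: lerXn2r sle; rewrite nnegrE.
have [s00|sn0] := eqVneq s 0; first by rewrite s00.
have sp : 0 < s by rewrite lt0r sn0.
have sm : s <= t ^+ (2 ^ H).
  apply: le_trans mt; rewrite -(ler_pXn2r nn0) ?nnegrE ?ler0n // sA.
  rewrite -[leRHS](mean_const N); apply: mean_le => u.
  by apply: lerXn2r; rewrite ?nnegrE ?ler0n //; apply: square_sum_le sys.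
(* Interpolation at the level s t: the part of Q above it is negligible
   since s <= t ^ (2 ^ H) and the exponent n.*2 is larger than 2 ^ H. *)
have Q2 : mean (fun u => Q u ^+ 2) <= 2 * s * t * Zp.
  have st0 : 0 < s * t by rewrite mulr_gt0.
  have en : (n.*2 = (n.*2 - 2).+2)%N by move: n0; clear; case: n => // n _; rewrite doubleS subn2.
  have := mean_sqr_interpolate (n.*2 - 2) Q0 st0; rewrite -/Z -en -sA => /le_trans; apply.
  have -> : s ^+ n.*2 / (s * t) ^+ (n.*2 - 2) = s ^+ 2 / t ^+ (n.*2 - 2).
    rewrite {1}en -[(n.*2 - 2).+2]add2n exprD exprMn; field.
    by rewrite !expf_neq0 // gt_eqF.
  have : s ^+ 2 / t ^+ (n.*2 - 2) <= s * t.
    rewrite ler_pdivrMr ?exprn_gt0 // expr2 -mulrA ler_pM2l // -exprS.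
    apply: le_trans sm _; apply: ler_weXn2l => //.
    have := Hn; have : (0 < 2 ^ H)%N by rewrite expn_gt0.
    by clear; move: (2 ^ H)%N => h; rewrite -muln2; lia.
  have : s * t * Z <= s * t * Zp by rewrite ler_pM2l.
  have : s * t * 1 <= s * t * Zp by rewrite ler_pM2l.
  rewrite (_ : 2 * s * t * Zp = 2 * (s * t * Zp)); last by ring.
  by rewrite mulr1; lra.
pose Y := c * (t ^+ j * Num.max 1 Z' + t ^+ (2 ^ (H - j))).
have Y0 : 0 <= Y.
  by rewrite /Y mulr_ge0 ?addr_ge0 ?mulr_ge0 ?exprn_ge0 ?le_max ?ler01 //; lra.
have [y y0 yY] := nth_root (isT : (0 < 2)%N) Y0.
have x2 : t ^+ (2 ^ (H - j)) = (t ^+ (2 ^ (H - j.+1))) ^+ 2.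
  by rewrite -exprM -expnSr subnSK.
apply: (@bootstrap_step _ s y (t ^+ j.+1 * Zp) _ c C Z) => //.
- by apply: mulr_ege1 => //; apply: exprn_ege1.
- by rewrite exprn_ge0 // ltW.
- by apply: le_trans ZZp _; rewrite ler_peMl ?exprn_ege1 //; lra.
- rewrite yY /Y x2; apply: ler_wpM2l; first by lra.
  rewrite lerD2r.
  have tj0 : 0 <= t ^+ j by rewrite exprn_ge0 // ltW.
  have tj : t ^+ j * 1 <= t ^+ j.+1 * Zp.
    rewrite exprS; apply: ler_pM => //; first by rewrite ler_peMl.
  have : Num.max 1 Z' <= 1 + 2 * s * t * Zp.
    rewrite ge_max lerDl !mulr_ge0 ?(ltW t0) //=; last by lra.
    by apply: le_trans Z'le (le_trans Q2 _); rewrite lerDr.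
  move/(ler_wpM2l tj0) => /le_trans; apply; rewrite mulrDr; apply: lerD => //.
  by rewrite le_eqVlt exprS; apply/orP; left; apply/eqP; ring.
have CY : mean (fun u => G u ^+ n.*2) <= (C * y) ^+ n.*2.
  apply: le_trans bG _; rewrite exprMn -[in y ^+ _]mul2n [y ^+ _]exprM yY.
  apply: ler_pM => //.
  - by lra.
  - by apply: mean_ge0 => u; rewrite exprn_ge0 ?square_sum_ge0.
  - by rewrite ler_eXnr //; lra.
have Cy0 : 0 <= C * y by rewrite mulr_ge0 //; lra.
rewrite -(ler_pXn2r nn0) ?nnegrE ?mulr_ge0 ?addr_ge0 // sA.
apply: (@le_trans _ _ (2 ^+ n.*2 * (Z ^+ n.*2 + mean (fun u => G u ^+ n.*2)))).
  rewrite -{1}(mean_const N (Z ^+ n.*2)) -meanD -meanZ; apply: mean_le => u.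
  have -> : G u ^+ n.*2 = `|G u| ^+ n.*2.
    by rewrite -mul2n !exprM real_normK ?num_real.
  apply: le_trans (exprD_le n.*2 Z0 (normr_ge0 (G u))); apply: lerXn2r.
  - exact: Q0.
  - by rewrite nnegrE addr_ge0.
  - by rewrite QG lerD2l ler_norm.
rewrite [leRHS]exprMn; apply: ler_wpM2l; first by rewrite exprn_ge0.
apply: le_trans (_ : Z ^+ n.*2 + (C * y) ^+ n.*2 <= _); first by rewrite lerD2l.
by rewrite -(prednK nn0); apply: exprD_ge.
Qed.

(** * Few sums force many free parts *)

Section FourthMoment.
Variables (R : realType) (N : nat).

Lemma mean_mul_sum_ge0 (I J : Type) (r : seq I) (s : seq J) (f : I -> int) (g : J -> int) :
  0 <= mean (fun t : 'I_N.+1 => (\sum_(i <- r) chi R (f i) t) * (\sum_(j <- s) chi R (g j) t)).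
Proof.
rewrite (_ : (fun t => _) = fun t => \sum_(i <- r) \sum_(j <- s) chi R (f i) t * chi R (g j) t).
  rewrite mean_sum sumr_ge0 // => i _; rewrite mean_sum sumr_ge0 // => j _.
  exact: mean_chi2_ge0.
by apply/funext => t; rewrite mulr_suml; apply: eq_bigr => i _; rewrite mulr_sumr.
Qed.

Lemma mean_chi_sqr_ge x : 1 / 2 <= mean (fun t : 'I_N.+1 => chi R x t * chi R x t).
Proof.
rewrite (_ : (fun t => _) = fun t => 2^-1 * (1 + chi R (x + x) t)); last first.
  by apply/funext => t; rewrite chiM subrr chi0 mulrC.
by rewrite meanZ meanD mean_const; have := mean_chi_ge0 R N (x + x); lra.
Qed.

Lemma sum_by_values (V : nmodType) (I : Type) (r : seq I) (f : I -> nat) (S : seq nat) (h : nat -> V) :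
  uniq S -> all (fun i => f i \in S) r ->
  \sum_(i <- r) h (f i) = \sum_(k < size S) h (nth 0%N S k) *+ count (fun i => f i == nth 0%N S k) r.
Proof.
move=> uS aS.
under [RHS]eq_bigr => k _ do rewrite -sum1_count -sumrMnr big_mkcond /=.
elim: r aS => [|i r IH] /= => [_|/andP[iS /IH e]].
  by rewrite big_nil big1 // => k _; rewrite big_nil.
rewrite big_cons e; under [RHS]eq_bigr => k _ do rewrite big_cons.
rewrite big_split /=; congr (_ + _).
have lt : (index (f i) S < size S)%N by rewrite index_mem.
rewrite (bigD1 (Ordinal lt)) //= nth_index // eqxx mulr1n big1 ?addr0 // => k kn.
case: eqP => // e'; case/negP: kn; rewrite -val_eqE /= e' index_uniq //.
Qed.

(** The fourth moment counts additive quadruples, and by the Cauchy-Schwarz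
    inequality there are many of them when there are few sums.  The square of
    the cosine sum is the half sum of D (differences) and P (sums); by
    positivity the mean of its square is bounded below by the part from P. *)
Lemma fourth_moment_ge (A S : seq nat) : uniq S ->
  (forall a b, a \in A -> b \in A -> (a + b)%N \in S) ->
  (size A)%:R ^+ 4 <= 8 * (size S)%:R * mean (fun t : 'I_N.+1 => (\sum_(a <- A) chi R a%:Z t) ^+ 4).
Proof.
move=> uS AS.
pose r := [seq (a, b) | a <- A, b <- A].
pose P (t : 'I_N.+1) := \sum_(x <- r) chi R (x.1%:Z + x.2%:Z) t : R.
pose D (t : 'I_N.+1) := \sum_(x <- r) chi R (x.1%:Z - x.2%:Z) t : R.
pose c (k : 'I_(size S)) : R := (count (fun x => (x.1 + x.2)%N == nth 0%N S k) r)%:R.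
have aS : all (fun x => (x.1 + x.2)%N \in S) r.
  by apply/allP => -[a b] /allpairsP [[a' b'] [/= h1 h2 [-> ->]]]; apply: AS.
have PE t : P t = \sum_k c k * chi R (nth 0%N S k)%:Z t.
  rewrite /P; under eq_bigr => x _ do rewrite -PoszD.
  rewrite (sum_by_values (fun x : nat => chi R x%:Z t) uS aS).
  by apply: eq_bigr => k _; rewrite mulr_natl.
have cS : \sum_k c k = (size A)%:R ^+ 2.
  have := sum_by_values (fun=> 1 : R) uS aS.
  by rewrite big_const_seq count_predT iter_addr_0 size_allpairs natrM -expr2 => ->.
have sq t : (\sum_(a <- A) chi R a%:Z t) ^+ 2 = (D t + P t) / 2.
  rewrite expr2 mulr_suml /D /P -big_split /= mulr_suml /r big_allpairs /=.
  apply: eq_bigr => a _; rewrite mulr_sumr; apply: eq_bigr => b _; exact: chiM.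
have PP : (\sum_k c k ^+ 2) / 2 <= mean (fun t : 'I_N.+1 => P t * P t).
  rewrite (_ : (fun t => _) = fun t => \sum_k \sum_l (c k * c l) *
     (chi R (nth 0%N S k)%:Z t * chi R (nth 0%N S l)%:Z t)); last first.
    apply/funext => t; rewrite !PE mulr_suml; apply: eq_bigr => k _.
    by rewrite mulr_sumr; apply: eq_bigr => l _; ring.
  rewrite mean_sum mulr_suml; apply: ler_sum => k _.
  rewrite mean_sum (bigD1 k) //= meanZ.
  apply: ler_wpDr.
    apply: sumr_ge0 => l _; rewrite meanZ; apply: mulr_ge0; last exact: mean_chi2_ge0.
    by rewrite mulr_ge0 ?ler0n.
  rewrite -expr2; apply: ler_wpM2l; first exact: sqr_ge0.
  by rewrite -[_^-1]mul1r; apply: mean_chi_sqr_ge.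
have m4 : mean (fun t : 'I_N.+1 => P t * P t) <=
    4 * mean (fun t : 'I_N.+1 => (\sum_(a <- A) chi R a%:Z t) ^+ 4).
  have h1 := mean_mul_sum_ge0 r r (fun x => x.1%:Z - x.2%:Z) (fun x => x.1%:Z - x.2%:Z).
  have h2 := mean_mul_sum_ge0 r r (fun x => x.1%:Z - x.2%:Z) (fun x => x.1%:Z + x.2%:Z).
  rewrite -/P -/D in h1 h2.
  rewrite -meanZ (_ : (fun t => 4 * _) = fun t => D t * D t + (2 * (D t * P t) + P t * P t)).
    by rewrite meanD meanD meanZ; move: h1 h2; rewrite /D /P; lra.
  by apply/funext => t; rewrite (exprM _ 2 2) sq; field.
have cs : (\sum_k c k) ^+ 2 <= (\sum_k c k ^+ 2) * (size S)%:R.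
  have := cauchy_schwarz c (fun=> 1 : R).
  by rewrite expr1n sumr_const card_ord; under eq_bigr do rewrite mulr1.
rewrite cS in cs.
rewrite (_ : 4%N = (2 * 2)%N) // exprM; apply: le_trans cs _.
rewrite [leRHS](_ : _ = 2 * (4 * mean (fun t : 'I_N.+1 => (\sum_(a <- A) chi R a%:Z t) ^+ 4)) * (size S)%:R); last by ring.
apply: ler_wpM2r; first exact: ler0n.
by move: (le_trans PP m4); lra.
Qed.

End FourthMoment.

Section InitialSystem.
Variables (ps A : seq nat).
Hypothesis prime_ps : all prime ps.
Hypothesis uA : uniq A.
Hypothesis posA : all (leq 1) A.

Definition free_part (a : nat) : nat := (a`_(in_ps ps)^')%N.
Definition free_parts : seq nat := undup [seq free_part a | a <- A].

Let X := (\max_(a <- A) a).+1.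
Let n := size free_parts.

Definition init_z (i : 'I_n) : int := (nth 0%N free_parts i)%:Z.
Definition init_W (i : 'I_n) : pred nat := fun v =>
  (in_ps ps).-nat v && ((v * nth 0%N free_parts i)%N \in A).

Let A_lt a : a \in A -> (0 < a < X)%N.
Proof.
move=> aA; rewrite (allP posA) // ltnS.
by rewrite (big_rem a) //= leq_maxl.
Qed.

Let nth_free (i : 'I_n) : nth 0%N free_parts i \in free_parts.
Proof. exact: mem_nth. Qed.

Let free_p'nat b : b \in free_parts -> (in_ps ps)^'.-nat b.
Proof. by rewrite mem_undup => /mapP[a aA ->]; apply: part_pnat. Qed.

Lemma free_coprime b p : (in_ps ps)^'.-nat b -> p \in ps -> ~~ (p %| b)%N.
Proof.
move=> bp pps; apply/negP => pd.
have pp : prime p by apply: (allP prime_ps).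
have b0 : (0 < b)%N by case/andP: bp.
by move/pnatP: bp => /(_ b0 p pp pd); rewrite inE /= inE pps.
Qed.

Lemma split_unique v b a : (in_ps ps).-nat v -> (in_ps ps)^'.-nat b -> (v * b)%N = a ->
  b = free_part a /\ v = (a`_(in_ps ps))%N.
Proof.
move=> sv fb <-; have v0 : (0 < v)%N by case/andP: sv.
have b0 : (0 < b)%N by case/andP: fb.
rewrite /free_part !partnM // [(v`_ _^')%N]part_p'nat ?pnatNK // mul1n part_pnat_id //.
by rewrite [(b`_ _)%N]part_p'nat // muln1 part_pnat_id.
Qed.

Lemma big_uniq1 (V : nmodType) (r : seq nat) (b : nat) (f : nat -> V) :
  uniq r -> b \in r -> \sum_(a <- r | a == b) f a = f b.
Proof. by move=> ur br; rewrite -big_filter filter_pred1_uniq // big_seq1. Qed.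

(** Every element of A is v * b in exactly one way with v composed of primes
    of ps and b one of the free parts. *)
Lemma sum_init (V : nmodType) (f : nat -> V) :
  \sum_(i < n) \sum_(v < X | init_W i v) f (v * nth 0%N free_parts i)%N = \sum_(a <- A) f a.
Proof.
pose b (i : 'I_n) := nth 0%N free_parts i.
transitivity (\sum_(x : 'I_n * 'I_X | init_W x.1 x.2) \sum_(a <- A | a == (x.2 * b x.1)%N) f a).
  rewrite pair_big_dep /=; apply: eq_bigr => -[i v] /= /andP[_ vA].
  by rewrite big_uniq1.
rewrite (exchange_big_dep xpredT) //=; apply: eq_big_seq => a aA.
have aX : (0 < a < X)%N by apply: A_lt.
have iP : (index (free_part a) free_parts < n)%N.
  by rewrite index_mem mem_undup map_f.
have vP : (a`_(in_ps ps) < X)%N.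
  by case/andP: aX => a0; apply: leq_ltn_trans; rewrite dvdn_leq // dvdn_part.
have bE : b (Ordinal iP) = free_part a by rewrite /b /= nth_index // mem_undup map_f.
have aE : a = (a`_(in_ps ps) * free_part a)%N by rewrite partnC //; case/andP: aX.
rewrite (big_pred1 (Ordinal iP, Ordinal vP)) // => -[i v] /=; rewrite xpair_eqE.
apply/andP/andP => [[/andP[sv _] /eqP e]|[/eqP -> /eqP ->]].
  have [e1 e2] := split_unique sv (free_p'nat (nth_free i)) (esym e).
  rewrite -!val_eqE /= -e2 eqxx -e1 index_uniq ?eqxx //; exact: undup_uniq.
by rewrite /init_W /= -/(b (Ordinal iP)) bE -aE eqxx aA part_pnat.
Qed.

Lemma init_system : (0 < size A)%N -> system ps (size A) X init_z init_W.
Proof.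
move=> A0; split.
- have [a aA] : exists a, a \in A by case: (A) A0 => // a A' _; exists a; apply: mem_head.
  have : free_part a \in free_parts by rewrite mem_undup map_f.
  by rewrite card_ord /n; case: free_parts.
- move=> i v /andP[sv vA]; split=> // [p pps|]; last by rewrite /init_z A_lt.
  by apply: free_coprime pps; apply: free_p'nat; apply: nth_free.
- move=> i; rewrite -sum1_size -(sum_init (fun=> 1%N)) (bigD1 i) //=; exact: leq_addr.
Qed.

Section Functions.
Variables (R : realType) (N : nat).
Hypothesis XN : (X.*2 <= N.+1)%N.
Hypothesis A0 : (0 < size A)%N.

Lemma sum_init_component t :
  \sum_(v < X) component R (N := N) init_z init_W v t = (\sum_(a <- A) chi R a%:Z t) / n%:R.
Proof.
rewrite -(sum_init (fun a => chi R a%:Z t)) /component card_ord -mulr_suml; congr (_ / _).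
rewrite exchange_big /=; apply: eq_bigr => i _; rewrite [RHS]big_mkcond.
apply: eq_bigr => v _; rewrite PoszM /init_z.
by case: (init_W i v); rewrite ?mul1r ?mul0r.
Qed.

Lemma mean_init_square_sum :
  mean (square_sum R (N := N) init_z init_W X) = (size A)%:R / 2 / n%:R ^+ 2.
Proof.
have half a b : (0 < a < X)%N -> (0 < b < X)%N ->
    mean (fun t : 'I_N.+1 => chi R a%:Z t * chi R b%:Z t) = (a == b)%:R / 2.
  move=> /andP[a0 aX] /andP[b0 bX].
  rewrite (_ : (fun t => _) = fun t => 2^-1 * (chi R (a%:Z - b%:Z) t + chi R (a%:Z + b%:Z) t)).
    rewrite meanZ meanD mulrC; congr (_ / _).
    rewrite [X in _ + X]mean_chi_eq0 ?addr0; last first.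
      apply/negP; rewrite dvdzE /= => /dvdn_leq; lia.
    have [->|ab] := eqVneq a b.
      rewrite subrr (eq_mean (h := fun=> 1)) ?mean_const // => t; exact: chi0.
    rewrite mean_chi_eq0 //; apply/negP; rewrite dvdzE => /dvdn_leq; lia.
  by apply/funext => t; rewrite chiM mulrC.
rewrite /square_sum mean_sum -[size A]sum1_size -(sum_init (fun=> 1%N)).
rewrite (exchange_big_dep xpredT) //=.
rewrite natr_sum !mulr_suml; apply: eq_bigr => v _.
rewrite (_ : (fun t => _) = fun t => (n%:R ^-1 ^+ 2) *
   \sum_i \sum_j ((init_W i v)%:R * (init_W j v)%:R) *
      (chi R (v%:Z * init_z i) t * chi R (v%:Z * init_z j) t)); last first.
  apply/funext => t; rewrite /component card_ord exprMn mulrC; congr (_ * _).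
  rewrite expr2 mulr_suml; apply: eq_bigr => x _; rewrite mulr_sumr; apply: eq_bigr => y _; ring.
rewrite meanZ mulrC exprVn; congr (_ / _).
rewrite mean_sum natr_sum mulr_suml [RHS]big_mkcond; apply: eq_bigr => i _.
rewrite mean_sum (bigD1 i) //= big1 ?addr0 => [|j ji]; rewrite meanZ.
  have [Wi|_] := boolP (init_W i v); last by rewrite !mul0r.
  have h : (0 < v * nth 0%N free_parts i < X)%N by case/andP: Wi => _ /A_lt.
  by rewrite !mul1r /init_z -PoszM half // eqxx mul1r.
have [Wi|_] := boolP (init_W i v); last by rewrite !mul0r.
have [Wj|_] := boolP (init_W j v); last by rewrite mulr0 mul0r.
have [_ h1] := andP Wi; have [_ h2] := andP Wj.
have v0 : (0 < v)%N by have /andP[] := A_lt h1; rewrite muln_gt0 => /andP[].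
rewrite !mul1r /init_z -!PoszM half ?A_lt // eqn_pmul2l // nth_uniq ?undup_uniq ?ltn_ord //.
by rewrite val_eqE eq_sym (negbTE ji) mul0r.
Qed.

End Functions.
End InitialSystem.

(** Interpolation between the first and the high moment.  The hypothesis on
    the mean guarantees that it is not much smaller than a negative power of
    t ^ (2 ^ H), so that the part of Q above the level B t is negligible even
    compared with the mean. *)
Lemma second_moment_from_high (R : realType) (N H : nat) (C t a n : R) (Q : 'I_N.+1 -> R) :
  (0 < H)%N -> 1 <= C -> 1 <= t -> 0 < n -> n <= a -> a <= t ^+ (2 ^ H) ->
  (forall u, 0 <= Q u) -> mean Q = a / 2 / n ^+ 2 ->
  mean (fun u => Q u ^+ (2 ^ (H + H).+1)) <=
    (C * (t ^+ H * Num.max 1 (mean Q) + t)) ^+ (2 ^ (H + H).+1) ->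
  mean (fun u => Q u ^+ 2) <=
    (1 + 4 * C) * (2 * C) * (t ^+ H.+1 * (mean Q * Num.max 1 (mean Q))).
Proof.
move=> H0 C1 t1 n0 na at' Q0 ZE mb.
have a0 : 0 < a by lra. have t0 : 0 < t by lra.
set Z := mean Q in ZE mb *; set Zp := Num.max 1 Z in mb *.
have Zgt : 0 < Z by rewrite ZE !divr_gt0 ?exprn_gt0.
have Zp1 : 1 <= Zp by rewrite le_max lexx.
set B := C * _ in mb.
have tH1 : 1 <= t ^+ H by apply: exprn_ege1.
have tHt : t <= t ^+ H by case: (H) H0 => // h _; rewrite exprS ler_peMr ?exprn_ege1 // ltW.
have B0 : 0 < B.
  by rewrite /B mulr_gt0 ?addr_gt0 ?mulr_gt0 ?exprn_gt0 //; lra.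
have Ble : B <= 2 * C * (t ^+ H * Zp).
  have : t ^+ H * 1 <= t ^+ H * Zp by rewrite ler_pM2l // exprn_gt0.
  have -> : 2 * C * (t ^+ H * Zp) = C * (2 * (t ^+ H * Zp)) by ring.
  rewrite /B mulr1 => h; apply: ler_wpM2l; lra.
clearbody B.
have [p [pE pge]] : exists p, (2 ^ (H + H).+1)%N = p.+2 /\ (H + 2 ^ H <= p.+1)%N.
  exists (2 ^ (H + H).+1 - 2)%N.
  have h1 : (2 ^ H.+1 <= 2 ^ (H + H).+1)%N by rewrite leq_exp2l // ltnS leq_addr.
  have h2 : (H < 2 ^ H)%N by apply: ltn_expl.
  rewrite expnS in h1.
  by move: h1 h2 H0; clear; move: (2 ^ H)%N (2 ^ _)%N; lia.
rewrite pE in mb.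
have tp : 0 < t ^+ p by apply: exprn_gt0.
have Bt : 0 < B * t by rewrite mulr_gt0.
apply: le_trans (mean_sqr_interpolate p Q0 Bt) _; rewrite -/Z.
have Bp : 0 < (B * t) ^+ p by apply: exprn_gt0.
have h1 : mean (fun u => Q u ^+ p.+2) / (B * t) ^+ p <= B * (B / t ^+ p).
  rewrite ler_pdivrMr //; apply: le_trans mb _; rewrite exprMn -[p.+2]add2n exprD.
  by rewrite le_eqVlt; apply/orP; left; apply/eqP; field; rewrite gt_eqF.
have ZZ : 1 <= 2 * t ^+ (2 ^ H) * Z.
  have : a * (a / n ^+ 2) <= t ^+ (2 ^ H) * (a / n ^+ 2).
    by apply: ler_wpM2r => //; rewrite divr_ge0 ?exprn_ge0 // ltW.
  have -> : 2 * t ^+ (2 ^ H) * Z = t ^+ (2 ^ H) * (a / n ^+ 2) by rewrite ZE; field; rewrite gt_eqF.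
  apply: le_trans; rewrite mulrA ler_pdivlMr ?exprn_gt0 // mul1r -expr2.
  by rewrite lerXn2r ?nnegrE // ltW.
have ZpZ : Zp <= 2 * t ^+ (2 ^ H) * Z.
  rewrite ge_max ZZ /= ler_peMl ?(ltW Zgt) //.
  by have := exprn_ege1 (2 ^ H) t1; lra.
have Ble2 : B / t ^+ p <= 4 * C * (t * Z).
  rewrite ler_pdivrMr //; apply: le_trans Ble _.
  have : t ^+ H * Zp <= t ^+ H * (2 * t ^+ (2 ^ H) * Z) by rewrite ler_pM2l // exprn_gt0.
  have : t ^+ (H + 2 ^ H) * Z <= t ^+ p.+1 * Z.
    by rewrite ler_pM2r // ler_weXn2l.
  rewrite exprD exprS => h2 h3.
  have h4 : t ^+ H * Zp <= 2 * (t * t ^+ p * Z).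
    by apply: le_trans h3 _; move: h2; set x := t ^+ H; set y := t ^+ (2 ^ H); lra.
  have -> : 4 * C * (t * Z) * t ^+ p = 2 * C * (2 * (t * t ^+ p * Z)) by ring.
  by apply: ler_wpM2l => //; lra.
apply: (@le_trans _ _ (B * (t * Z * (1 + 4 * C)))).
  have -> : B * (t * Z * (1 + 4 * C)) = B * t * Z + B * (4 * C * (t * Z)) by ring.
  by rewrite lerD2l; apply: le_trans h1 _; rewrite ler_pM2l.
have tz : 0 <= t * Z * (1 + 4 * C) by apply: mulr_ge0; [rewrite mulr_ge0 // ltW | lra].
apply: le_trans (ler_wpM2r tz Ble) _.
by rewrite le_eqVlt exprS; apply/orP; left; apply/eqP; ring.
Qed.

(** In the system whose indices are the n free parts, the components add up to
    the cosine sum of A divided by n, and the mean of Q is |A| / (2 n^2).  The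
    square function inequality bounds the fourth moment by the mean of Q^2,
    which is almost the mean of Q times its maximum with 1; fourth_moment_ge
    turns this into a lower bound for the number of sums.  When n^2 is the larger term,
    the sums outnumber A by the square of the average fibre size |A| / n, up
    to a small power of |A|. *)
Theorem sumset_bound (R : realType) (r H : nat) : (0 < H)%N -> exists2 C : R, 1 <= C &
  forall (ps A S : seq nat) (t : R), (size ps <= r)%N -> all prime ps ->
  uniq A -> all (leq 1) A -> (0 < size A)%N -> uniq S ->
  (forall a b, a \in A -> b \in A -> (a + b)%N \in S) ->
  1 <= t -> (size A)%:R <= t ^+ (2 ^ H) ->
  (size A)%:R ^+ 3 <=
    C * t ^+ H.+1 * (size S)%:R * Num.max ((size (free_parts ps A))%:R ^+ 2) (size A)%:R.
Proof.
move=> H0.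
have [C C1 HC] := moment_bound R r (leqnn H).
have [D D1 HD] := square_function_system R 1 r.
have C0 : 0 <= C by lra. have D0 : 0 <= D by lra.
exists (8 * D * ((1 + 4 * C) * (2 * C))).
  by rewrite !mulr_ege1 //; lra.
move=> ps A S t sz pps uA posA A0 uS AS t1 mt.
have t0 : 0 < t by lra.
set n := size (free_parts ps A).
(* The modulus N.+1 exceeds all frequencies of the first H.+1 systems, and so
   do the powers p ^ K that divide it. *)
pose X := (\max_(a <- A) a).+1.
pose K := (X + H.+1)%N.
have M0 : (0 < (2 * \prod_(p <- ps) p) ^ K)%N.
  rewrite expn_gt0 muln_gt0 /= big_seq prodn_cond_gt0 // => p pin.
  by rewrite prime_gt0 // (allP pps).
pose N := ((2 * \prod_(p <- ps) p) ^ K).-1.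
have NE : N.+1 = ((2 * \prod_(p <- ps) p) ^ K)%N by rewrite /N prednK.
have pK p : p \in ps -> (p ^ K %| N.+1)%N.
  move=> pin; rewrite NE dvdn_exp2r // dvdn_mull // (big_rem p) //= dvdn_mulr //.
have XK : (X * 2 ^ H.+1 <= 2 ^ K)%N.
  by rewrite /K expnD leq_mul2r ltnW ?orbT // ltn_expl.
have KN : (2 ^ K <= N.+1)%N.
  rewrite NE expnMn leq_pmulr //; move: M0; by rewrite expnMn muln_gt0 => /andP[].
have sys : system ps (size A) X (@init_z ps A) (@init_W ps A) by apply: init_system.
set Q := square_sum R (N := N) (@init_z ps A) (@init_W ps A) X.
have XN : (X.*2 <= N.+1)%N.
  apply: leq_trans KN; apply: leq_trans XK; rewrite -muln2 leq_mul2l expnS.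
  by rewrite leq_pmulr ?orbT // expn_gt0.
have ZE : mean Q = (size A)%:R / 2 / n%:R ^+ 2 by apply: mean_init_square_sum.
have mb : mean (fun u => Q u ^+ (2 ^ (H + H).+1)) <=
   (C * (t ^+ H * Num.max 1 (mean Q) + t ^+ (2 ^ (H - H)))) ^+ (2 ^ (H + H).+1).
  apply: (HC N K _ X ps t sz pps pK _ _ t1 mt _ _ _ sys).
  - by apply: leq_trans XK; rewrite leq_mul2l leq_exp2l // leqnSn orbT.
  - exact: leq_trans XK KN.
have sf : mean (fun u => (\sum_(v < X) component R (N := N) (@init_z ps A) (@init_W ps A) v u) ^+ 4)
   <= D * mean (fun u => Q u ^+ 2).
  apply: (HD N K _ X ps sz pps pK _ _ _ _ sys).
  by apply: leq_trans XK; rewrite leq_pmulr // expn_gt0.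
have f4 := fourth_moment_ge R N uS AS.
have Q0 u : 0 <= Q u by apply: square_sum_ge0.
have n0 : (0 < n)%N by case: sys; rewrite card_ord.
have nA : (n <= size A)%N by rewrite /n (leq_trans (size_undup _)) ?size_map.
have Q2 : mean (fun u => Q u ^+ 2) <=
    (1 + 4 * C) * (2 * C) * (t ^+ H.+1 * (mean Q * Num.max 1 (mean Q))).
  apply: (@second_moment_from_high R N H C t (size A)%:R n%:R) => //.
  - by rewrite ltr0n.
  - by rewrite ler_nat.
  - by rewrite subnn expn0 expr1 in mb.
have {sf} sf : mean (fun u : 'I_N.+1 => (\sum_(a <- A) chi R a%:Z u) ^+ 4) <= n%:R ^+ 4 * (D * mean (fun u => Q u ^+ 2)).
  have n4 : 0 < n%:R ^+ 4 :> R by rewrite exprn_gt0 // ltr0n.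
  apply: le_trans _ (ler_wpM2l (ltW n4) sf); rewrite -meanZ; apply: mean_le => u.
  by rewrite sum_init_component // -/n exprMn exprVn mulrCA divff ?mulr1 // gt_eqF.
rewrite ZE in Q2.
have nR : 0 < n%:R :> R by rewrite ltr0n.
have aR : 0 < (size A)%:R :> R by rewrite ltr0n.
have tH : 0 <= t ^+ H.+1 by rewrite exprn_ge0 // ltW.
rewrite -(ler_pM2l aR) -exprS.
apply: le_trans f4 _; apply: le_trans (ler_wpM2l _ sf) _; first by rewrite mulr_ge0 ?ler0n.
set M := Num.max (n%:R ^+ 2) _.
have ZM : n%:R ^+ 4 * ((size A)%:R / 2 / n%:R ^+ 2 * Num.max 1 ((size A)%:R / 2 / n%:R ^+ 2)) <= (size A)%:R * M.
  have e (Y : R) : n%:R ^+ 4 * ((size A)%:R / 2 / n%:R ^+ 2 * Y)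
     = (size A)%:R / 2 * (n%:R ^+ 2 * Y) by field; rewrite gt_eqF.
  rewrite e.
  apply: ler_pM.
  - by rewrite divr_ge0 // ltW.
  - by rewrite mulr_ge0 ?exprn_ge0 ?le_max ?ler01 // ltW.
  - by lra.
  have n2 : 0 < n%:R ^+ 2 :> R by apply: exprn_gt0.
  rewrite maxr_pMr ?(ltW n2) // mulr1 [X in Num.max _ X](_ : _ = (size A)%:R / 2).
    by rewrite ge_max !le_max lexx /=; apply/orP; right; lra.
  by field; rewrite gt_eqF.
have E0 : 0 <= 8 * (size S)%:R * D * ((1 + 4 * C) * (2 * C)) * t ^+ H.+1.
  by rewrite !mulr_ge0 ?ler0n ?addr_ge0 ?mulr_ge0.
have n4 : 0 <= n%:R ^+ 4 :> R by rewrite exprn_ge0 // ler0n.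
have s0 : 0 <= 8 * (size S)%:R :> R by rewrite mulr_ge0 ?ler0n.
apply: le_trans (ler_wpM2l s0 (ler_wpM2l n4 (ler_wpM2l D0 Q2))) _.
have := ler_wpM2l E0 ZM; set U := _ * Num.max 1 _; clearbody U M.
have -> : 8 * (size S)%:R * (n%:R ^+ 4 * (D * ((1 + 4 * C) * (2 * C) * (t ^+ H.+1 * U))))
  = 8 * (size S)%:R * D * ((1 + 4 * C) * (2 * C)) * t ^+ H.+1 * (n%:R ^+ 4 * U) by ring.
move/le_trans; apply; rewrite le_eqVlt; apply/orP; left; apply/eqP; ring.
Qed.

(** * Products of integers with few prime factors *)

Section NatCounting.
Local Open Scope nat_scope.

Lemma size_fibers (T U : eqType) (f : T -> U) (l : seq T) (s : seq U) (D : nat) :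
  (forall x, x \in l -> f x \in s) ->
  (forall y, y \in s -> count (fun x => f x == y) l <= D) ->
  size l <= D * size s.
Proof.
move=> fs cD.
have -> : size l = \sum_(y <- undup s) count (fun x => f x == y) l.
  elim: l fs {cD} => [|x l IH] fs; first by rewrite big1.
  rewrite /= big_split /= -IH; last by move=> z zl; apply: fs; rewrite inE zl orbT.
  rewrite -add1n; congr (_ + _).
  rewrite (bigD1_seq (f x)) ?undup_uniq ?mem_undup ?fs ?mem_head //= eqxx.
  by rewrite big1 // => y; rewrite eq_sym => /negbTE ->.
apply: (@leq_trans (\sum_(y <- undup s) D)).
  rewrite big_seq [leqRHS]big_seq; apply: leq_sum => y; rewrite mem_undup; exact: cD.
by rewrite big_const_seq count_predT iter_addn_0 leq_mul2l size_undup orbT.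
Qed.

Lemma size_inj_card (T : eqType) (U : finType) (g : T -> U) (l : seq T) :
  uniq l -> {in l &, injective g} -> size l <= #|U|.
Proof.
move=> ul inj; rewrite -(size_map g) -(card_uniqP _); first exact: max_card.
by rewrite map_inj_in_uniq.
Qed.

(** Greedy extraction: as long as a prime outside ps divides more than a
    proportion 1 / L of A, add it to ps and keep its multiples.  The elements of A
    have at most k prime divisors, all of ps among them, so that there are at
    most d further rounds. *)
Lemma heavy_primes (L k d : nat) (ps A : seq nat) :
  uniq ps -> all prime ps -> uniq A -> 0 < size A ->
  (forall a, a \in A -> 0 < a /\ size (primes a) <= k) ->
  (forall a p, a \in A -> p \in ps -> p %| a) ->
  size ps + d = k -> 0 < L ->
  exists qs B, [/\ all prime qs, size qs <= k, uniq B, {subset B <= A} &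
    0 < size B /\ size A <= size B * L ^ d /\
    forall p, prime p -> p \notin qs -> count (fun a => p %| a) B * L <= size B].
Proof.
elim: d ps A => [|d IH] ps A ups pps uA A0 HA Hp szd L0.
all: have [[p [pp [pn heavy]]]|nH] := pselect (exists p, prime p /\ (p \notin ps /\
       size A < count (fun a => p %| a) A * L)).
- exfalso; have : 0 < count (fun a => p %| a) A.
    by rewrite lt0n; apply/eqP => c0; rewrite c0 mul0n in heavy.
  rewrite -has_count => /hasP[a aA pa]; have [a0 sz] := HA a aA.
  suff : size (p :: ps) <= size (primes a) by move: sz; rewrite /= -szd addn0 => h1 h2; have := leq_trans h2 h1; rewrite ltnn.
  apply: uniq_leq_size => [/=|q]; first by rewrite pn ups.
  rewrite inE mem_primes a0 => /orP[/eqP ->|qps]; first by rewrite pp pa.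
  by rewrite (allP pps) // Hp.
- exists ps, A; split=> //; first by rewrite -szd leq_addr.
  split=> //; split=> [|p pp pn]; first by rewrite expn0 muln1.
  rewrite leqNgt; apply/negP => h; apply: nH; by exists p.
- pose A1 := [seq a <- A | p %| a].
  have c0 : 0 < size A1.
    by rewrite size_filter lt0n; apply/eqP => c0; rewrite c0 mul0n in heavy.
  have [|||||||| qs [B [h1 h2 h3 h4 [h5 [h6 h7]]]]] := IH (p :: ps) A1.
  + by rewrite /= pn ups.
  + by rewrite /= pp.
  + exact: filter_uniq.
  + by [].
  + by move=> a; rewrite mem_filter => /andP[_ /HA].
  + move=> a q; rewrite mem_filter inE => /andP[pa aA] /orP[/eqP -> //|]; exact: Hp.
  + by rewrite /= -szd addnS.
  + by [].
  exists qs, B; split=> //; first by move=> a /h4; rewrite mem_filter => /andP[].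
  split=> //; split=> //.
  rewrite expnSr mulnA; apply: leq_trans (ltnW heavy) _.
  by rewrite leq_mul2r -size_filter h6 orbT.
- exists ps, A; split=> //; first by rewrite -szd leq_addr.
  split=> //; split=> [|p pp pn]; first by rewrite leq_pmulr // expn_gt0 L0.
  rewrite leqNgt; apply/negP => h; apply: nH; by exists p.
Qed.

(** Pigeonhole over the dyadic size of the fibre through an element; whole
    fibres are kept or dropped, so that their sizes do not change. *)
Lemma dyadic_fibers (f : nat -> nat) (A : seq nat) : uniq A -> 0 < size A ->
  exists m B, [/\ 0 < m, uniq B, {subset B <= A}, size A <= size B * (trunc_log 2 (size A)).+1 &
    forall a, a \in B -> m <= count (fun x => f x == f a) B <= m.*2].
Proof.
move=> uA A0; pose fib b := count (fun x => f x == b) A.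
pose J := (trunc_log 2 (size A)).+1.
pose cls j := [seq a <- A | trunc_log 2 (fib (f a)) == j].
have clsJ a : trunc_log 2 (fib (f a)) < J.
  by rewrite ltnS; apply: leq_trunc_log; apply: count_size.
have sumcls : \sum_(j < J) size (cls j) = size A.
  under eq_bigr => j _ do rewrite size_filter -sum1_count big_mkcond.
  rewrite exchange_big /= -sum1_size; apply: eq_bigr => a _.
  rewrite (bigD1 (Ordinal (clsJ a))) //= eqxx big1 ?addn0 // => j.
  by rewrite -val_eqE /= eq_sym => /negbTE ->.
have [j jP] : exists j : 'I_J, size A <= size (cls j) * J.
  apply/existsP; rewrite -[[exists _, _]]negbK negb_exists; apply/negP => /forallP H.
  have : \sum_(j < J) (size (cls j) * J).+1 <= \sum_(j < J) size A.
    by apply: leq_sum => j _; rewrite ltnNge.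
  have -> : \sum_(j < J) (size (cls j) * J).+1 = size A * J + J.
    rewrite -{1}sumcls big_distrl /= -[X in _ + X]muln1 -[in X in _ + X](card_ord J).
    rewrite -sum_nat_const -big_split /=.
    by apply: eq_bigr => j _; rewrite addn1.
  by rewrite sum_nat_const card_ord mulnC -{2}[J * size A]addn0 leq_add2l.
exists (2 ^ j), (cls j); split=> //.
- by rewrite expn_gt0.
- exact: filter_uniq.
- by move=> a; rewrite mem_filter => /andP[].
move=> a; rewrite mem_filter => /andP[/eqP ej aA].
have -> : count (fun x => f x == f a) (cls j) = fib (f a).
  rewrite count_filter; apply: eq_count => x /=; case: eqP => //= e.
  by rewrite e ej eqxx.
have f0 : 0 < fib (f a) by rewrite -has_count; apply/hasP; exists a.
have /andP[h1 h2] := trunc_log_bounds (isT : 1 < 2) f0.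
by rewrite -ej h1 /= -mul2n -expnS ltnW.
Qed.

Lemma logn_coprime_factor (p c d : nat) : 0 < c -> 0 < d -> coprime c d ->
  logn p c = if p \in primes c then logn p (c * d) else 0.
Proof.
move=> c0 d0 cd; case: ifP => [|/negbT pc]; last first.
  by apply/eqP; rewrite -leqn0 leqNgt logn_gt0.
rewrite mem_primes => /and3P[pp _ pc]; rewrite lognM //.
have nd : ~~ (p %| d).
  apply/negP => pd; have : p %| gcdn c d by rewrite dvdn_gcd pc.
  by rewrite (eqP cd) dvdn1 => /eqP p1; rewrite p1 in pp.
by rewrite [logn p d]lognE pp d0 (negbTE nd) addn0.
Qed.

(** A factorization into two coprime factors is determined by which primes
    go to the first factor. *)
Lemma coprime_factor_inj (y c d c' d' : nat) : 0 < c -> 0 < d -> 0 < c' -> 0 < d' ->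
  coprime c d -> coprime c' d' -> c * d = y -> c' * d' = y ->
  (forall p, p \in primes y -> (p %| c) = (p %| c')) -> c = c'.
Proof.
move=> c0 d0 c0' d0' cd cd' e e' H; apply: eqn_from_log => // p.
rewrite (logn_coprime_factor _ c0 d0 cd) (logn_coprime_factor _ c0' d0' cd') e e'.
have y0 : 0 < y by rewrite -e muln_gt0 c0.
suff -> : (p \in primes c) = (p \in primes c') by [].
rewrite !mem_primes c0 c0' /=; case pp: (prime p) => //=.
have py u v : u * v = y -> p %| u -> p \in primes y.
  by move=> uv pu; rewrite mem_primes pp y0 -uv dvdn_mulr.
by apply/idP/idP => h; [rewrite -H | rewrite H] => //; [apply: py e h | apply: py e' h].
Qed.

Section Products.
Variables (ps A S : seq nat) (k m : nat).
Hypothesis prime_ps : all prime ps.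
Hypothesis uA : uniq A.
Hypothesis HA : forall a, a \in A -> 0 < a /\ size (primes a) <= k.
Hypothesis AS : forall a b, a \in A -> b \in A -> a * b \in S.
Hypothesis k0 : 0 < k.
Hypothesis m0 : 0 < m.
Hypothesis fibers : forall a, a \in A ->
  m <= count (fun x => free_part ps x == free_part ps a) A <= m.*2.
Hypothesis light : forall p, prime p -> p \notin ps ->
  count (fun a => p %| a) A * (4 * k) <= size A.

Let f := free_part ps.
Let B := free_parts ps A.
Let n := size B.

Let f_gt0 a : 0 < f a. Proof. exact: part_gt0. Qed.
Let f_dvd a : f a %| a. Proof. exact: dvdn_part. Qed.

Let BP b : b \in B -> exists2 a, a \in A & b = f a.
Proof. by rewrite mem_undup => /mapP. Qed.

Let sum_fibers (P : pred nat) :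
  \sum_(b <- B | P b) count (fun x => f x == b) A = count (fun x => P (f x)) A.
Proof.
under eq_bigr do rewrite -sum1_count big_mkcond.
rewrite exchange_big /= -sum1_count [RHS]big_mkcond big_seq [RHS]big_seq.
apply: eq_bigr => a aA.
rewrite big_mkcond (bigD1_seq (f a)) ?undup_uniq ?mem_undup ?map_f //= eqxx.
rewrite big1 ?addn0 // => b; rewrite eq_sym => /negbTE ->; by case: ifP.
Qed.

Let size_A_le : size A <= n * m.*2.
Proof.
have <- : \sum_(b <- B) count (fun x => f x == b) A = size A by rewrite sum_fibers count_predT.
apply: (@leq_trans (\sum_(b <- B) m.*2)); last first.
  by rewrite big_const_seq count_predT iter_addn_0 mulnC.
rewrite big_seq [leqRHS]big_seq; apply: leq_sum => b /BP[a aA ->].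
by case/andP: (fibers aA).
Qed.

(** Each of the at most k prime divisors of f a lies outside ps, so it divides
    at most a proportion 1 / (4 k) of the elements of A.  As the fibres have
    equal size up to a factor 2, it divides at most a proportion 1 / (2 k) of
    the free parts. *)
Let coprime_many a : a \in A -> n <= (count (coprime (f a)) B).*2.
Proof.
move=> aA; have [a0 sa] := HA aA.
have bad : count (predC (coprime (f a))) B * (4 * k * m) <= k * size A.
  apply: (@leq_trans (\sum_(p <- primes (f a)) size A)); last first.
    rewrite big_const_seq count_predT iter_addn_0 mulnC leq_mul2r; apply/orP; right.
    apply: leq_trans sa; apply: uniq_leq_size; first exact: primes_uniq.
    move=> p; rewrite !mem_primes a0 => /and3P[-> _ pa] /=; exact: dvdn_trans (f_dvd a).
  apply: (@leq_trans (\sum_(p <- primes (f a)) (count (fun b => p %| b) B * (4 * k * m)))).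
    rewrite -big_distrl /= leq_mul2r; apply/orP; right.
    rewrite -sum1_count; under [leqRHS]eq_bigr do rewrite -sum1_count big_mkcond.
    rewrite exchange_big /= big_mkcond; apply: leq_sum => b _; case: ifP => //= nc.
    have g1 : 1 < gcdn (f a) b.
      by rewrite ltn_neqAle eq_sym gcdn_gt0 f_gt0 andbT.
    have pd := pdiv_dvd (gcdn (f a) b); rewrite dvdn_gcd in pd; case/andP: pd => pd1 pd2.
    rewrite (bigD1_seq (pdiv (gcdn (f a) b))) ?primes_uniq //=; first by rewrite pd2.
    by rewrite mem_primes pdiv_prime // f_gt0.
  rewrite big_seq [leqRHS]big_seq; apply: leq_sum => p; rewrite mem_primes => /and3P[pp _ pfa].
  have pn : p \notin ps.
    by apply: contraL pfa => pin; apply: (free_coprime prime_ps) => //; apply: part_pnat.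
  apply: leq_trans (light pp pn).
  rewrite [_ * m]mulnC mulnA leq_mul2r; apply/orP; right.
  apply: (@leq_trans (count (fun x => p %| f x) A)); last first.
    by apply: sub_count => x /= h; apply: dvdn_trans (f_dvd x).
  rewrite -(sum_fibers (fun b => p %| b)) -sum1_count big_distrl /=.
  rewrite big_seq_cond [leqRHS]big_seq_cond; apply: leq_sum => b /andP[/BP[x xA ->] _].
  by rewrite mul1n; case/andP: (fibers xA).
have := leq_trans bad (_ : _ <= k * (n * m.*2)); rewrite leq_mul2l size_A_le orbT => /(_ isT).
have -> : n = count (coprime (f a)) B + count (predC (coprime (f a))) B by rewrite count_predC.
move: (count _ B) (count _ B) => x y.
rewrite (_ : y * (4 * k * m) = (k * m) * (4 * y)); last by lia.
rewrite (_ : k * ((x + y) * m.*2) = (k * m) * (2 * (x + y))); last by rewrite -!muln2; lia.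
by rewrite leq_pmul2l ?muln_gt0 ?k0 //; lia.
Qed.

(* An arbitrary element with free part b; the default 0 is never reached. *)
Let rep b := head 0 [seq x <- A | f x == b].

Let repP b : b \in B -> rep b \in A /\ f (rep b) = b.
Proof.
move=> /BP[a aA ->]; rewrite /rep.
have : a \in [seq x <- A | f x == f a] by rewrite mem_filter eqxx.
case E: [seq x <- A | f x == f a] => [//|x s] _ /=.
have : x \in [seq x <- A | f x == f a] by rewrite E mem_head.
by rewrite mem_filter => /andP[/eqP].
Qed.

Let fM a b : 0 < a -> 0 < b -> f (a * b) = f a * f b.
Proof. by move=> a0 b0; rewrite /f /free_part partnM. Qed.

(** Send (a, b), with b coprime to the free part of a, to a * rep b.  The free
    part of the product is f a * b, which has at most 2 k prime divisors, and
    the set of those dividing f a determines f a, then b, then a. *)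
Lemma product_bound : size A * n <= 2 * 4 ^ k * size S.
Proof.
pose l := [seq x <- [seq (a, b) | a <- A, b <- B] | coprime (f x.1) x.2].
have ul : uniq l by rewrite filter_uniq // allpairs_uniq ?undup_uniq // => -[a b] [a' b'].
have lP x : x \in l -> [/\ x.1 \in A, x.2 \in B & coprime (f x.1) x.2].
  by rewrite mem_filter => /andP[c /allpairsP[[a b] /= [h1 h2 e]]]; rewrite e in c *.
have sl : size A * n <= (size l).*2.
  have -> : size l = \sum_(a <- A) count (coprime (f a)) B.
    rewrite size_filter -sum1_count big_mkcond big_allpairs /=.
    by apply: eq_bigr => a _; rewrite -big_mkcond sum1_count.
  rewrite -muln2 big_distrl /= -[size A]sum1_size big_distrl /=.
  rewrite big_seq [leqRHS]big_seq; apply: leq_sum => a aA.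
  by rewrite mul1n muln2; apply: coprime_many.
suff : size l <= 4 ^ k * size S by rewrite -muln2 in sl; lia.
apply: (@size_fibers _ _ (fun x => x.1 * rep x.2)) => [x /lP[h1 h2 _]|y yS].
  by apply: AS => //; case: (repP h2).
rewrite -size_filter; set fl := [seq x <- l | _].
have ufl : uniq fl by apply: filter_uniq.
have flP x : x \in fl -> [/\ x.1 \in A, x.2 \in B, coprime (f x.1) x.2, x.1 * rep x.2 = y & f x.1 * x.2 = f y].
  rewrite mem_filter => /andP[/eqP e /lP[h1 h2 h3]]; split=> //.
  have [r1 r2] := repP h2.
  by rewrite -e fM ?r2 //; [case: (HA h1) | case: (HA r1)].
have [->|nz] := eqVneq fl [::]; first by rewrite leq0n.
have [x0 x0f] : exists x, x \in fl.
  by case: (fl) nz => // x s _; exists x; rewrite mem_head.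
have szp : size (primes (f y)) <= 2 * k.
  have [h1 h2 _ _ <-] := flP _ x0f; have [r1 r2] := repP h2.
  have [a0 sa] := HA h1; have [b0 sb] := HA r1.
  apply: (@leq_trans (size (primes x0.1 ++ primes (rep x0.2)))); last by rewrite size_cat mul2n -addnn leq_add.
  apply: uniq_leq_size; first exact: primes_uniq.
  move=> p; rewrite mem_cat !mem_primes a0 b0 => /and3P[pp _].
  have rd : x0.2 %| rep x0.2 by rewrite -{1}r2 f_dvd.
  rewrite Euclid_dvdM // pp /= => /orP[] h; first by rewrite (dvdn_trans h (f_dvd _)).
  by rewrite (dvdn_trans h rd) orbT.
pose g (x : nat * nat) := [tuple of map (fun p => p %| f x.1) (in_tuple (primes (f y)))].
apply: leq_trans (size_inj_card (g := g) ufl _) _; last first.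
  by rewrite card_tuple card_bool (_ : 4 = 2 ^ 2) // -expnM leq_exp2l.
move=> [a b] [a' b'] /flP[/= h1 h2 h3 h4 h5] /flP[/= h1' h2' h3' h4' h5'] /(congr1 val) /= /eq_in_map eg.
have [r1 r2] := repP h2; have [r1' r2'] := repP h2'.
have bpos : 0 < b by rewrite -r2.
have bpos' : 0 < b' by rewrite -r2'.
have ef : f a = f a' by apply: (coprime_factor_inj _ bpos _ bpos' h3 h3' h5 h5') => // p /eg.
have eb : b = b' by apply/eqP; rewrite -(eqn_pmul2l (f_gt0 a)) h5 ef h5'.
have [rpos _] := HA r1.
congr pair => //; apply/eqP; rewrite -(eqn_pmul2r rpos) h4 eb h4'; exact: eqxx.
Qed.
End Products.

End NatCounting.

(** * Sums and products together *)

(** With b = |B|, s = |S| and n free parts, sumset_bound and product_bound give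
    either b^2 <= C T s, or b^3 <= C T s n^2 and b n <= E M.  The first is
    cubed, using b^5 <= b^6; in the second, b^5 = b^3 b^2 <= C T s (b n)^2. *)
Theorem sum_product_nat (R : realType) (k H : nat) : (0 < k)%N -> (0 < H)%N ->
  exists2 C : R, 1 <= C & forall (A S D : seq nat) (M : nat) (t : R),
  uniq A -> (0 < size A)%N ->
  (forall a, a \in A -> (0 < a)%N /\ (size (primes a) <= k)%N) ->
  uniq S -> (forall a b, a \in A -> b \in A -> (a + b)%N \in S) ->
  (forall a b, a \in A -> b \in A -> (a * b)%N \in D) ->
  (size S <= M)%N -> (size D <= M)%N ->
  1 <= t -> (size A)%:R <= t ^+ (2 ^ H) ->
  (size A)%:R ^+ 5 <=
    C * (4 * k * (trunc_log 2 (size A)).+1)%:R ^+ (5 * k.+1) * t ^+ (3 * H.+1) * M%:R ^+ 3.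
Proof.
move=> k0 H0; have [C C1 HC] := sumset_bound R k H0.
exists (C ^+ 3 * (2 * 4 ^ k)%:R ^+ 2).
  by rewrite mulr_ege1 ?exprn_ege1 // ler1n muln_gt0 expn_gt0.
move=> A S D M t uA A0 HA uS AS AD SM DM t1 At.
set J := (trunc_log 2 (size A)).+1; set L := (4 * k * J)%N.
have L0 : (0 < L)%N by rewrite !muln_gt0 k0.
have [||ps [B1 [pps szp uB1 sB1 [B10 [B1s light1]]]]] :=
    @heavy_primes L k k [::] A isT isT uA A0 HA _ _ L0; [by [] | by [] |].
have [m [B [m0 uB sB Bs fib]]] := dyadic_fibers (free_part ps) uB1 B10.
have sBA a : a \in B -> a \in A by move=> /sB /sB1.
have szB1 : (size B1 <= size A)%N by apply: uniq_leq_size.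
have Bs' : (size B1 <= size B * J)%N.
  by apply: leq_trans Bs _; rewrite leq_mul2l ltnS leq_trunc_log ?orbT.
have B0 : (0 < size B)%N by move: (leq_trans B10 Bs'); rewrite muln_gt0 => /andP[].
have AB : (size A <= size B * L ^ k.+1)%N.
  apply: leq_trans B1s _; rewrite expnS mulnA leq_mul2r; apply/orP; right.
  apply: leq_trans Bs' _; rewrite leq_mul2l; apply/orP; right.
  by rewrite /L leq_pmull // muln_gt0 k0.
(* L contains the factor J lost in passing from B1 to B. *)
have light p : prime p -> p \notin ps ->
    (count (fun a => p %| a)%N B * (4 * k) <= size B)%N.
  move=> pp pn; rewrite -(@leq_pmul2r J) //; apply: leq_trans _ Bs'.
  apply: leq_trans _ (light1 p pp pn); rewrite /L -!mulnA leq_mul2r; apply/orP; right.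
  rewrite -!size_filter; apply: uniq_leq_size; first exact: filter_uniq.
  by move=> a; rewrite !mem_filter => /andP[-> /sB].
have HB a : a \in B -> (0 < a)%N /\ (size (primes a) <= k)%N by move=> /sBA /HA.
have ASB a b : a \in B -> b \in B -> (a + b)%N \in S by move=> /sBA h1 /sBA; apply: AS.
have ADB a b : a \in B -> b \in B -> (a * b)%N \in D by move=> /sBA h1 /sBA; apply: AD.
have pb := product_bound pps uB HB ADB k0 m0 fib light.
have posB : all (leq 1) B by apply/allP => a /HB [].
have BA : (size B)%:R <= t ^+ (2 ^ H).
  by apply: le_trans At; rewrite ler_nat; apply: uniq_leq_size.
have sb := HC ps B S t szp pps uB posB B0 uS ASB t1 BA.
set n := size (free_parts ps B) in pb sb.
set b : R := (size B)%:R in BA sb *.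
set T := t ^+ H.+1 in sb.
have T1 : 1 <= T by apply: exprn_ege1.
have b1 : 1 <= b by rewrite ler1n.
have MR : (size S)%:R <= M%:R :> R by rewrite ler_nat.
have M0 : 0 <= M%:R :> R by rewrite ler0n.
set E : R := (2 * 4 ^ k)%:R.
have E1 : 1 <= E by rewrite /E ler1n muln_gt0 expn_gt0.
have pR : b * n%:R <= E * M%:R.
  rewrite -!natrM ler_nat; apply: leq_trans pb _; by rewrite leq_mul2l DM orbT.
have CT : 1 <= C * T by apply: mulr_ege1.
have core : b ^+ 5 <= C ^+ 3 * E ^+ 2 * T ^+ 3 * M%:R ^+ 3.
  have sb' : b ^+ 3 <= C * T * M%:R * Num.max (n%:R ^+ 2) b.
    apply: le_trans sb _; apply: ler_wpM2r; first by rewrite le_max sqr_ge0.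
    by apply: ler_wpM2l => //; lra.
  have CTM : 0 <= C * T * M%:R by rewrite mulr_ge0 //; lra.
  have [le|le] := leP (n%:R ^+ 2) b.
    rewrite (max_idPr le) exprSr ler_pM2r in sb'; last by lra.
    have h : (b ^+ 2) ^+ 3 <= (C * T * M%:R) ^+ 3 by rewrite lerXn2r ?nnegrE ?sqr_ge0.
    apply: (@le_trans _ _ ((b ^+ 2) ^+ 3)); first by rewrite -exprM ler_weXn2l.
    apply: le_trans h _.
    rewrite (_ : C ^+ 3 * _ * _ * _ = E ^+ 2 * (C * T * M%:R) ^+ 3); last by ring.
    by apply: ler_peMl; [apply: exprn_ge0 | apply: exprn_ege1].
  rewrite (max_idPl (ltW le)) in sb'.
  have h : b ^+ 5 <= C * T * M%:R * (b * n%:R) ^+ 2.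
    rewrite exprMn mulrCA -[5%N]/(2 + 3)%N exprD; apply: ler_wpM2l => //; exact: sqr_ge0.
  apply: le_trans h _.
  have h2 : (b * n%:R) ^+ 2 <= (E * M%:R) ^+ 2.
    by rewrite lerXn2r ?nnegrE ?mulr_ge0 ?ler0n //; lra.
  apply: le_trans (ler_wpM2l CTM h2) _; rewrite exprMn.
  rewrite (_ : C * T * M%:R * (E ^+ 2 * M%:R ^+ 2) = C * T * (E ^+ 2 * M%:R ^+ 3)); last by ring.
  rewrite (_ : C ^+ 3 * E ^+ 2 * T ^+ 3 * M%:R ^+ 3 = (C * T) ^+ 3 * (E ^+ 2 * M%:R ^+ 3)); last by ring.
  apply: ler_wpM2r; first by rewrite mulr_ge0 ?exprn_ge0 //; lra.
  by rewrite ler_eXnr.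
have AR : (size A)%:R ^+ 5 <= b ^+ 5 * L%:R ^+ (5 * k.+1).
  rewrite mulnC [in leRHS]exprM -exprMn; apply: lerXn2r.
  - by rewrite nnegrE ler0n.
  - by rewrite nnegrE mulr_ge0 ?exprn_ge0 ?ler0n //; lra.
  - by rewrite -natrX -natrM ler_nat.
apply: le_trans AR _.
have L5 : 0 <= L%:R ^+ (5 * k.+1) :> R by rewrite exprn_ge0 // ler0n.
apply: le_trans (ler_wpM2r L5 core) _.
rewrite [(3 * H.+1)%N]mulnC [t ^+ (H.+1 * 3)]exprM -/T le_eqVlt; apply/orP; left; apply/eqP.
by move: (L%:R ^+ _ : R) => l; ring.
Qed.

(** * Integers with few prime divisors *)

Local Open Scope classical_set_scope.
Local Open Scope ring_scope.

Lemma omega_size (R : realType) (a : int) (k : nat) (s : seq nat) :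
  (omega R a <= k%:R%:E)%E -> uniq s -> (forall p, p \in s -> prime p /\ (p%:Z %| a)%Z) ->
  (size s <= k)%N.
Proof.
rewrite /omega /counting; case: asboolP => // fX; rewrite lee_fin ler_nat => h us sP.
apply: leq_trans h; apply: uniq_leq_size => // p /sP pX.
by have := in_fset_set fX p => ->; rewrite inE.
Qed.

(** Every prime divides 0, so that omega of 0 exceeds every bound. *)
Lemma omega_neq0 (R : realType) (a : int) (k : nat) :
  (omega R a <= k%:R%:E)%E -> a != 0.
Proof.
move=> h; apply/eqP => a0; rewrite a0 in h.
have [s [us sp ss]] : exists s, [/\ uniq s, all prime s & size s = k.+1].
  elim: (k.+1) => [|j [s [us sp ss]]]; first by exists [::].
  have [p pm pp] := prime_above (\max_(q <- s) q).
  exists (p :: s); rewrite /= pp us ss sp; split=> //; rewrite andbT.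
  by apply/negP => pin; move: pm; rewrite ltnNge (big_rem p) //= leq_maxl.
have := omega_size h us; rewrite ss ltnn => H.
by suff : false by []; apply: H => p /(allP sp) pp; split => //; rewrite dvdz0.
Qed.

Lemma omega_primes (R : realType) (a : int) (k : nat) :
  (omega R a <= k%:R%:E)%E -> (size (primes `|a|%N) <= k)%N.
Proof.
move=> h; apply: (omega_size h (primes_uniq _)) => p.
by rewrite mem_primes => /and3P[pp _ pa]; split => //; rewrite dvdzE.
Qed.

(** With y = ln N, both 1 + trunc_log 2 N <= B exp(a y) and the constant are
    controlled by 1 + u <= exp u; the exponent a is chosen such that the
    D-th power uses up only half of e y. *)
Lemma polylog_le_power (R : realType) (k D : nat) (C e : R) : 0 < C -> 0 < e ->
  exists N0 : nat, forall N : nat, (N0 <= N)%N -> (0 < N)%N ->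
    C * (4 * k * (trunc_log 2 N).+1)%:R ^+ D <= (N%:R : R) `^ e.
Proof.
move=> C0 e0.
have l2 : 0 < ln (2 : R) by apply: ln_gt0; rewrite ltr1n.
pose a := e / (2 * D.+1%:R).
have D0 : 0 < D.+1%:R :> R by rewrite ltr0n.
have a0 : 0 < a by rewrite divr_gt0 // mulr_gt0.
pose B := 1 + 1 / (ln 2 * a).
have B0 : 0 < B by rewrite /B addr_gt0 // divr_gt0 // mulr_gt0.
pose K := C * ((4 * k)%:R * B) ^+ D.
have K0 : 0 <= K by rewrite mulr_ge0 ?exprn_ge0 ?mulr_ge0 ?ler0n // ltW.
exists (Num.bound (expR (2 * K / e))) => N hN N0.
have NR : 0 < N%:R :> R by rewrite ltr0n.
pose y := ln (N%:R : R).
have y0 : 0 <= y by apply: ln_ge0; rewrite ler1n.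
have yK : 2 * K / e <= y.
  rewrite -ler_expR /y lnK ?posrE //; apply: ltW.
  by apply: lt_le_trans (archi_boundP (expR_ge0 _)) _; rewrite ler_nat.
have jy : (trunc_log 2 N)%:R * ln 2 <= y.
  rewrite mulr_natl -lnXn // /y ler_ln ?posrE ?exprn_gt0 //.
  by rewrite -natrX ler_nat; have /andP[] := trunc_log_bounds (isT : (1 < 2)%N) N0.
have jB : (trunc_log 2 N).+1%:R <= B * expR (a * y).
  apply: (@le_trans _ _ (B * (1 + a * y))); last by rewrite ler_pM2l // expR_ge1Dx.
  have -> : B * (1 + a * y) = 1 + y / ln 2 + a * y + 1 / (ln 2 * a).
    by rewrite /B; field; rewrite !gt_eqF.
  rewrite -natr1 addrC -!addrA lerD2l; apply: ler_wpDr; last by rewrite ler_pdivlMr.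
  by rewrite addr_ge0 ?mulr_ge0 ?divr_ge0 ?invr_ge0 ?mulr_ge0 // ltW.
rewrite /powR gt_eqF // -/y.
pose w := e * y / 2.
have eD : (B * expR (a * y)) ^+ D <= B ^+ D * expR w.
  rewrite exprMn ler_pM2l ?exprn_gt0 // -expRM_natl ler_expR /w.
  rewrite mulrA -[e * y / 2]mulrAC; apply: ler_wpM2r => //.
  have -> : e / 2 = D.+1%:R * a by rewrite /a; field; rewrite gt_eqF.
  by apply: ler_wpM2r; [exact: ltW | rewrite ler_nat].
have h1 : C * (4 * k * (trunc_log 2 N).+1)%:R ^+ D <= K * expR w.
  rewrite /K exprMn -!mulrA ler_pM2l // natrM exprMn.
  apply: ler_wpM2l; first by rewrite exprn_ge0 // ler0n.
  apply: le_trans _ eD; apply: lerXn2r => //.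
  - by rewrite nnegrE ler0n.
  - by rewrite nnegrE mulr_ge0 ?expR_ge0 // ltW.
apply: le_trans h1 _.
have -> : e * y = w + w by rewrite /w; field.
rewrite expRD; apply: ler_wpM2r; first exact: expR_ge0.
apply: le_trans _ (expR_ge1Dx _); apply: ler_wpDl => //.
by move: yK; rewrite ler_pdivrMr // /w => yK; lra.
Qed.

(** * The exponent 5/3 *)

(** H = 2 h works as soon as h exceeds 6 / e, since 2 ^ h > h. *)
Lemma small_exponent (R : realType) (e : R) : 0 < e ->
  exists2 H : nat, (0 < H)%N & (3 * H.+1)%:R / (2 ^ H)%:R <= e.
Proof.
move=> e0; pose h := (Num.bound (6 / e)).+1; exists (2 * h)%N; first by rewrite muln_gt0.
have h0 : 0 < h.+1%:R :> R by rewrite ltr0n.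
have hb : 6 / e <= h.+1%:R.
  apply: ltW; apply: lt_le_trans (archi_boundP _) _; first by rewrite divr_ge0 // ltW.
  by rewrite ler_nat /h; do 2 apply: ltnW.
apply: (@le_trans _ _ (6 / h.+1%:R)); last first.
  by rewrite ler_pdivrMr //; move: hb; rewrite ler_pdivrMr // mulrC.
rewrite ler_pdivrMr ?ltr0n ?expn_gt0 // mulrAC ler_pdivlMr // -!natrM ler_nat.
apply: (@leq_trans (6 * (h.+1 * h.+1))); first by rewrite mulnA leq_mul2r; apply/orP; right; lia.
by rewrite leq_mul2l /= mulnC expnM [(_ ^ 2)%N]expnS expn1 leq_mul // ltn_expl.
Qed.

(** The power of t in sum_product_nat is at most N^e by the choice of H, and
    the logarithmic factor is at most N^e for large N. *)
Theorem sum_product_power (R : realType) (k : nat) (e : R) : (0 < k)%N -> 0 < e ->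
  exists N0 : nat, forall (A S D : seq nat) (M : nat),
  uniq A -> (N0 <= size A)%N ->
  (forall a, a \in A -> (0 < a)%N /\ (size (primes a) <= k)%N) ->
  uniq S -> (forall a b, a \in A -> b \in A -> (a + b)%N \in S) ->
  (forall a b, a \in A -> b \in A -> (a * b)%N \in D) ->
  (size S <= M)%N -> (size D <= M)%N ->
  ((size A)%:R : R) `^ (5 / 3 - e) <= M%:R.
Proof.
move=> k0 e0; have [H H0 He] := small_exponent e0.
have [C C1 HC] := sum_product_nat R k0 H0.
have C0 : 0 < C by lra.
have [N0 HN0] := polylog_le_power k (5 * k.+1) C0 e0.
exists N0.+1 => A S D M uA NA HA uS AS AD SM DM.
have A0 : (0 < size A)%N by apply: leq_trans NA.
have h1 := HN0 (size A) (ltnW NA) A0.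
set x : R := (size A)%:R in h1 *.
have x1 : 1 <= x by rewrite ler1n.
have x0 : 0 <= x by lra.
have xn0 : x != 0 by rewrite gt_eqF //; lra.
pose t := x `^ (1 / (2 ^ H)%:R).
have pH : (2 ^ H)%:R != 0 :> R by rewrite pnatr_eq0 -lt0n expn_gt0.
have t1 : 1 <= t.
  by rewrite -(powRr0 x) ler_powR // divr_ge0 ?ler0n.
have tH : x <= t ^+ (2 ^ H).
  by rewrite -powR_mulrn ?powR_ge0 // -powRrM divfK // powRr1.
have t3 : t ^+ (3 * H.+1) <= x `^ e.
  rewrite -powR_mulrn ?powR_ge0 // -powRrM; apply: ler_powR => //.
  by rewrite mulrC mulrA mulr1.
have main := HC A S D M t uA A0 HA uS AS AD SM DM t1 tH.
rewrite -/x in main.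
have M0 : 0 <= M%:R :> R by apply: ler0n.
have xe : 0 < x `^ e by rewrite powR_gt0 //; lra.
have xe1 : 1 <= x `^ e by rewrite -(powRr0 x) ler_powR // ltW.
have b5 : x ^+ 5 <= (x `^ e) ^+ 3 * M%:R ^+ 3.
  apply: le_trans main _; apply: ler_wpM2r; first exact: exprn_ge0.
  apply: (@le_trans _ _ (x `^ e * x `^ e)).
    apply: ler_pM => //.
    - by apply: mulr_ge0; [exact: ltW | rewrite exprn_ge0 // ler0n].
    - by rewrite exprn_ge0 //; lra.
  by rewrite -expr2 ler_weXn2l.
have e3 : (x `^ (5 / 3 - e)) ^+ 3 * (x `^ e) ^+ 3 = x ^+ 5.
  rewrite -exprMn -powRD; last by rewrite xn0 implybT.
  rewrite subrK -[LHS]powR_mulrn ?powR_ge0 // -powRrM divfK ?pnatr_eq0 //.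
  by rewrite powR_mulrn.
have : (x `^ (5 / 3 - e)) ^+ 3 <= M%:R ^+ 3.
  by rewrite -(ler_pM2r (exprn_gt0 3 xe)) e3 mulrC.
by rewrite ler_pXn2r ?nnegrE ?powR_ge0.
Qed.

(** Multiplication by the sign s preserves sums up to sign and does not change
    products. *)
Lemma same_sign_half (A : {fset int}) : (forall a, a \in A -> a != 0) ->
  exists (s : int) (L : seq nat), [/\ s * s = 1, uniq L, (#|` A| <= (size L).*2)%N &
    forall x, x \in L -> (0 < x)%N /\ s * x%:Z \in A].
Proof.
move=> A0.
pose L (s : int) := [seq `|a|%N | a <- enum_fset A & 0 < s * a].
have LP s : s * s = 1 -> uniq (L s) /\ forall x, x \in L s -> (0 < x)%N /\ s * x%:Z \in A.
  move=> ss.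
  have absE a : 0 < s * a -> s * `|a|%N%:Z = a.
    have : s = 1 \/ s = -1 by nia.
    by case=> ->; rewrite ?mul1r ?mulN1r; lia.
  split.
    rewrite map_inj_in_uniq ?filter_uniq ?fset_uniq // => a b.
    by rewrite !mem_filter => /andP[/absE ea _] /andP[/absE eb _] e; rewrite -ea -eb e.
  move=> x /mapP[a]; rewrite mem_filter => /andP[sa aA ->]; rewrite absE //; split=> //.
  by rewrite absz_gt0 A0.
have [uP HP] := LP 1 (mulr1 1); have [uM HM] := LP (-1) (mulrNN 1 1).
have cov : (#|` A| <= size (L 1%R) + size (L (-1)%R))%N.
  rewrite !size_map !size_filter; set l := enum_fset A.
  rewrite -(count_predC (fun a : int => 0 < 1 * a) l) leq_add2l -!size_filter.
  apply: uniq_leq_size; first by rewrite filter_uniq ?fset_uniq.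
  move=> a; rewrite !mem_filter => /andP[/= na aA]; rewrite aA andbT.
  by have := A0 a aA; move: na; rewrite mul1r mulN1r; lia.
have [le|/ltnW le] := leqP (size (L (-1)%R)) (size (L 1%R)).
  by exists 1, (L 1); split=> //; apply: leq_trans cov _; rewrite -addnn leq_add2l.
exists (-1), (L (-1)); split=> //.
by apply: leq_trans cov _; rewrite -addnn leq_add2r.
Qed.

(** Passing to the elements of one sign costs the factor 1 / 4, since
    2 ^ (5 / 3 - e) <= 4. *)
Lemma sum_product_fset (R : realType) (k : nat) (e : R) : (0 < k)%N -> 0 < e -> e <= 1 ->
  exists N0 : nat, forall A : {fset int}, (N0 <= #|` A|)%N ->
  (forall a : int, a \in A -> (omega R a <= k%:R%:E)%E) ->
  1 / 4 * (#|` A|%:R : R) `^ (5 / 3 - e) <= (maxn #|` sumset A| #|` prodset A|)%:R.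
Proof.
move=> k0 e0 e1; have [N0 HN] := sum_product_power k0 e0.
exists N0.*2.+1 => A NA HA.
have [s [L [ss uL AL LP]]] := same_sign_half (fun a aA => omega_neq0 (HA a aA)).
pose S := undup [seq (a + b)%N | a <- L, b <- L].
pose D := undup [seq (a * b)%N | a <- L, b <- L].
have sS : (size S <= #|` sumset A|)%N.
  rewrite -(size_map (fun x : nat => s * x%:Z)); apply: uniq_leq_size.
    rewrite map_inj_uniq ?undup_uniq // => x y /(congr1 ( *%R s)).
    by rewrite !mulrA ss !mul1r => -[].
  move=> _ /mapP[x xS ->]; move: xS; rewrite mem_undup => /allpairsP[[a b] /= [aL bL ->]].
  rewrite PoszD mulrDr; apply/imfset2P; exists (s * a%:Z); first by case: (LP _ aL).
  by exists (s * b%:Z); first by case: (LP _ bL).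
have sD : (size D <= #|` prodset A|)%N.
  rewrite -(size_map Posz); apply: uniq_leq_size.
    by rewrite map_inj_uniq ?undup_uniq // => x y [].
  move=> _ /mapP[x xD ->]; move: xD; rewrite mem_undup => /allpairsP[[a b] /= [aL bL ->]].
  have -> : (a * b)%:Z = (s * a%:Z) * (s * b%:Z) by rewrite mulrACA ss mul1r PoszM.
  apply/imfset2P; exists (s * a%:Z); first by case: (LP _ aL).
  by exists (s * b%:Z); first by case: (LP _ bL).
have NL : (N0 <= size L)%N by move: (leq_trans NA AL); rewrite ltn_double => /ltnW.
have LR : #|` A|%:R <= 2 * (size L)%:R :> R by rewrite -natrM ler_nat mul2n.
have AL0 : (0 < #|` A|)%N by apply: leq_trans NA.
apply: (@le_trans _ _ ((size L)%:R `^ (5 / 3 - e))); last first.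
  apply: (HN L S D) => //.
  - move=> a /LP[a0 saA]; split=> //; have := omega_primes (HA _ saA).
    have -> : `|(s * a%:Z)%R|%N = a.
      have : s = 1 \/ s = -1 by clear -ss; nia.
      by case=> ->; rewrite ?mul1r ?mulN1r ?abszN.
    by [].
  - exact: undup_uniq.
  - by move=> a b aL bL; rewrite mem_undup; apply: allpairs_f.
  - by move=> a b aL bL; rewrite mem_undup; apply: allpairs_f.
  - by rewrite leq_max sS.
  - by rewrite leq_max sD orbT.
have ex0 : 0 <= 5 / 3 - e by lra.
have p1 := ge0_ler_powR ex0 (_ : _ \in Num.nneg) (_ : _ \in Num.nneg) LR.
have {p1} : (#|` A|%:R : R) `^ (5 / 3 - e) <= (2 * (size L)%:R) `^ (5 / 3 - e).
  by apply: p1; rewrite nnegrE ?mulr_ge0 ?ler0n.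
rewrite powRM ?ler0n // => h.
have p2 : (2 : R) `^ (5 / 3 - e) <= 4.
  apply: (@le_trans _ _ ((2 : R) `^ 2%:R)); first by apply: ler_powR; lra.
  by rewrite powR_mulrn //; lra.
rewrite mul1r [4^-1 * _]mulrC ler_pdivrMr // [_ * 4]mulrC; apply: le_trans h _.
by apply: ler_wpM2r => //; apply: powR_ge0.
Qed.

Theorem corollary1p2 (R : realType) (eps : R) (k : nat)
    (eps_gt0 : 0 < eps) (eps_lt : eps < 1 / 6) (k_gt0 : (0 < k)%N) :
  exists (n0 : nat) (c : R) (delta : nat -> R),
    [/\ 0 < c,
        delta n @[n --> \oo] --> (0 : R) &
        forall A : {fset int},
          (n0 <= #|` A|)%N ->
          (forall a : int, a \in A -> (omega R a <= k%:R%:E)%E) ->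
          k%:R <= ln (#|` A|%:R : R) `^ (1 - 6 * eps) ->
          c * (#|` A|%:R : R) `^ (5 / 3 - delta #|` A|)
            <= (maxn #|` sumset A| #|` prodset A|)%:R].
Proof.
have inv0 (i : nat) : 0 < (i.+1%:R : R)^-1 by rewrite invr_gt0 ltr0n.
have inv1 (i : nat) : (i.+1%:R : R)^-1 <= 1 by rewrite invf_le1 ?ltr0n // ler1n.
have [N_ HN] := choice (fun i => sum_product_fset k_gt0 (inv0 i) (inv1 i)).
(* Diagonal choice: best n tends to infinity because every threshold N_ i is
   finite, and for n >= N_ 0 it is an index i to which HN applies. *)
pose best n := (\max_(i < n.+1 | (N_ i <= n)%N) i)%N.
exists (N_ 0%N), (1 / 4), (fun n => ((best n).+1%:R)^-1); split.
- by rewrite divr_gt0.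
- apply/cvgr0Pnorm_lt => e e0.
  pose i0 := Num.bound e^-1.
  near=> n.
  have i0n : (i0 < n.+1)%N by rewrite ltnS; near: n; apply: nbhs_infty_ge.
  have Nn : (N_ i0 <= n)%N by near: n; apply: nbhs_infty_ge.
  have ib : (i0 <= best n)%N.
    exact: (@leq_bigmax_cond _ (fun i : 'I_n.+1 => (N_ i <= n)%N) (fun i => i : nat) (Ordinal i0n)).
  rewrite ger0_norm ?(ltW (inv0 _)) // invf_plt ?posrE ?ltr0n //.
  apply: lt_le_trans (archi_boundP _) _; first by rewrite invr_ge0 ltW.
  by rewrite ler_nat; apply: leq_trans ib _.
- move=> A NA HA _; set n := #|` A| in NA *.
  have ne : (0 < #|(fun i : 'I_n.+1 => (N_ i <= n)%N)|)%N.
    by apply/card_gt0P; exists ord0; rewrite unfold_in.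
  have [i iP ->] : exists2 i : 'I_n.+1, (N_ i <= n)%N & best n = i.
    by have [i iP e] := eq_bigmax_cond (fun i : 'I_n.+1 => i : nat) ne; exists i.
  exact: HN.
Unshelve. all: by end_near.
Qed.
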